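(* Let $(M,\pi_0,\mathcal{N})$ be an orientable Poisson-Nijenhuis manifold and assume that $\mathcal{N}$ is non-degenerate (invertible at every point of $M$). For $i\in\mathbb{Z}$ let $\pi_i=\mathcal{N}^i\pi_0$, i.e. $\pi_i^\sharp=\mathcal{N}^i\pi_0^\sharp$, and set $$h_0=-\tfrac12\log|\det\mathcal{N}|,\qquad h_i=-\tfrac1{2i}\operatorname{tr}\mathcal{N}^i\quad(i\in\mathbb{Z},\ i\neq0).$$ Then the modular vector field $X_{\mathcal{N}}$ of $(M,\pi_0,\mathcal{N})$ is bi-hamiltonian, i.e. it is hamiltonian relative to both $\pi_0$ and $\pi_1$, and it determines a hierarchy of flows: there are vector fields $X_k$ ($k\in\mathbb{Z}$), with $X_1=X_{\mathcal{N}}$, such that $$X_{i+j}=\pi_i^\sharp\,\mathrm{d}h_j=\pi_j^\sharp\,\mathrm{d}h_i\qquad\text{for all } i,j\in\mathbb{Z}.$$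
   Context: Everything is smooth. For a Poisson manifold $(M,\pi)$: $\{f,g\}=\pi(\mathrm{d}f,\mathrm{d}g)$, $\pi^\sharp:T^*M\to TM$ is defined by $\langle\beta,\pi^\sharp\alpha\rangle=\pi(\alpha,\beta)$, and the hamiltonian vector field of $h$ is $X_h=\pi^\sharp\mathrm{d}h=\{h,\cdot\}$. For a volume form $\mu$ on $M$, the divergence of a vector field $X$ is the function with $\mathcal{L}_X\mu=\operatorname{div}_\mu(X)\mu$, and the modular vector field of $\pi$ relative to $\mu$ is the vector field $X_\mu$ with $X_\mu(f)=\operatorname{div}_\mu(X_f)$ for all $f\in C^\infty(M)$. The bracket on 1-forms associated with a bivector $\pi$ is $[\alpha,\beta]_\pi=\mathcal{L}_{\pi^\sharp\alpha}\beta-\mathcal{L}_{\pi^\sharp\beta}\alpha-\mathrm{d}(\pi(\alpha,\beta))$. A Poisson-Nijenhuis manifold $(M,\pi_0,\mathcal{N})$ is a manifold $M$ with a Poisson structure $\pi_0$ and a $(1,1)$-tensor $\mathcal{N}:TM\to TM$ such that: (i) the Nijenhuis torsion vanishes, i.e. $\mathcal{N}[\mathcal{N}X,Y]+\mathcal{N}[X,\mathcal{N}Y]-\mathcal{N}^2[X,Y]-[\mathcal{N}X,\mathcal{N}Y]=0$ for all vector fields $X,Y$; (ii) $\mathcal{N}\pi_0^\sharp=\pi_0^\sharp\mathcal{N}^*$ ($\mathcal{N}^*$ is the transpose), so that $\pi_1=\mathcal{N}\pi_0$, defined by $\pi_1^\sharp=\mathcal{N}\pi_0^\sharp$, is a bivector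 field; (iii) $[\alpha,\beta]_{\pi_1}=[\mathcal{N}^*\alpha,\beta]_{\pi_0}+[\alpha,\mathcal{N}^*\beta]_{\pi_0}-\mathcal{N}^*[\alpha,\beta]_{\pi_0}$ for all 1-forms $\alpha,\beta$. Then $\pi_1$ is a Poisson tensor. Let $X^0_\mu$ and $X^1_\mu$ be the modular vector fields of $\pi_0$ and $\pi_1$ relative to a volume form $\mu$. The modular vector field of the Poisson-Nijenhuis manifold is $X_{\mathcal{N}}:=X^1_\mu-\mathcal{N}X^0_\mu$; it does not depend on the choice of $\mu$. *)

(* Defs.v *)
From HB Require Import structures.
From mathcomp Require Import all_boot all_order all_algebra.
From mathcomp Require Import all_classical all_reals all_analysis.

Set Implicit Arguments.
Unset Strict Implicit.
Unset Printing Implicit Defensive.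

Import Order.TTheory GRing.Theory Num.Theory.
Import numFieldNormedType.Exports.

Local Open Scope classical_set_scope.
Local Open Scope ring_scope.

Section EuclideanSpace.
Context {R : realType} {n : nat}.
Implicit Types (f : 'rV[R]_n -> R) (U : set 'rV[R]_n).

Definition partial (i : 'I_n) f : 'rV[R]_n -> R :=
  fun x => 'D_(delta_mx 0 i) f x.

Definition iter_partial (s : seq 'I_n) f : 'rV[R]_n -> R := foldr partial f s.

(* C^oo on the open set U: the iterated partial derivatives of every order
   exist and are continuous on U. *)
Definition smooth_on U f : Prop :=
  forall (s : seq 'I_n) (x : 'rV[R]_n), U x ->
    {for x, continuous (iter_partial s f)} /\
    forall i : 'I_n, derivable (iter_partial s f) x (delta_mx 0 i).

End EuclideanSpace.

(* A chart is a homeomorphism from an open set of M onto an open set of R^n.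
   The values of cmap outside cdom, and of cinv outside the image, are
   irrelevant. *)
Record chart (R : realType) (n : nat) (M : topologicalType) := Chart {
  cdom : set M;
  cmap :> M -> 'rV[R]_n;
  cinv : 'rV[R]_n -> M;
  open_cdom : open cdom;
  open_cimage : open (cmap @` cdom);
  cmapK : {in cdom, cancel cmap cinv};
  cmap_continuous : forall p, cdom p -> {for p, continuous cmap};
  cinv_continuous : forall x, (cmap @` cdom) x -> {for x, continuous cinv}
}.

Record smoothManifold (R : realType) (n : nat) := SmoothManifold {
  carrier :> topologicalType;
  manifold_hausdorff : hausdorff_space carrier;
  manifold_second_countable : @second_countable carrier;
  atlas : set (chart R n carrier);
  atlas_cover : forall p : carrier, exists c, atlas c /\ cdom c p;
  atlas_compatible : forall c d, atlas c -> atlas d -> forall i : 'I_n,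
    smooth_on (d @` (cdom c `&` cdom d)) (fun x => c (cinv d x) 0 i)
}.

Section Manifold.
Context {R : realType} {n : nat} {M : smoothManifold R n}.
Implicit Types (p : M) (c d : chart R n M) (f g h : M -> R).

Definition chart_at p : chart R n M := projT1 (cid (atlas_cover p)).

Definition smooth f : Prop :=
  forall c, atlas c -> smooth_on (c @` cdom c) (f \o cinv c).

(* The partial derivative of f at p along the i-th coordinate of c. *)
Definition pd c (i : 'I_n) f : M -> R := fun p => partial i (f \o cinv c) (c p).

(* Matrix of d(c o d^-1) at p: it maps the components of a tangent vector at p
   in the chart d to its components in the chart c. *)
Definition jac c d p : 'M[R]_n := \matrix_(i, j) pd d j (fun q => c q 0 i) p.

(* The tangent space at p is identified with 'cV[R]_n, and the cotangent space
   with 'rV[R]_n, by means of the coordinate bases of the chart chart_at p; the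
   pairing is the matrix product. A section of a tensor bundle is thus a
   function on M, and no relation between the values at different points is
   implied: smoothness is that of the components in the charts of the atlas.
   - an endomorphism field is a field of matrices acting on 'cV[R]_n by left
     multiplication, and its transpose acts on 'rV[R]_n by right
     multiplication;
   - a bivector field pi is encoded by the matrix of pi^sharp : T^*M -> TM in
     the coordinate bases, whose (j, i) entry is pi(dx_i, dx_j);
   - an n-form is evaluated at n-tuples of tangent vectors. *)
Definition vfield := M -> 'cV[R]_n.
Definition oneform := M -> 'rV[R]_n.
Definition endfield := M -> 'M[R]_n.
Definition bivfield := M -> 'M[R]_n.
Definition topform := M -> ('I_n -> 'cV[R]_n) -> R.

(* Components in the chart c, meaningful on cdom c. *)
Definition vfield_in c (X : vfield) : M -> 'cV[R]_n :=
  fun p => jac c (chart_at p) p *m X p.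
Definition oneform_in c (a : oneform) : M -> 'rV[R]_n :=
  fun p => a p *m jac (chart_at p) c p.
Definition endfield_in c (N : endfield) : M -> 'M[R]_n :=
  fun p => jac c (chart_at p) p *m N p *m jac (chart_at p) c p.
Definition bivfield_in c (S : bivfield) : M -> 'M[R]_n :=
  fun p => jac c (chart_at p) p *m S p *m (jac c (chart_at p) p)^T.
Definition topform_in c (mu : topform) : M -> ('I_n -> 'cV[R]_n) -> R :=
  fun p v => mu p (fun k => jac (chart_at p) c p *m v k).

Definition smooth_mx (m k : nat) (T : chart R n M -> M -> 'M[R]_(m, k)) : Prop :=
  forall c, atlas c -> forall i j,
    smooth_on (c @` cdom c) (fun x => T c (cinv c x) i j).

Definition smooth_vfield (X : vfield) : Prop := smooth_mx (vfield_in ^~ X).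
Definition smooth_oneform (a : oneform) : Prop := smooth_mx (oneform_in ^~ a).
Definition smooth_endfield (N : endfield) : Prop := smooth_mx (endfield_in ^~ N).
Definition smooth_bivfield (S : bivfield) : Prop := smooth_mx (bivfield_in ^~ S).
Definition smooth_topform (mu : topform) : Prop :=
  forall c, atlas c -> forall v : 'I_n -> 'cV[R]_n,
    smooth_on (c @` cdom c) (fun x => topform_in c mu (cinv c x) v).

Definition diffl f : oneform := fun p => \row_i pd (chart_at p) i f p.

Definition pairing (a : oneform) (X : vfield) : M -> R := fun p => (a p *m X p) 0 0.

(* X(f) *)
Definition act (X : vfield) f : M -> R := pairing (diffl f) X.

(* The matrix of the partial derivatives d_j X^i in the chart chart_at p. *)
Definition jacv (X : vfield) p : 'M[R]_n :=
  \matrix_(i, j) pd (chart_at p) j (fun q => vfield_in (chart_at p) X q i 0) p.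

(* Lie derivatives at p, written in the coordinates of chart_at p:
     (L_X Y)^i = X(Y^i) - Y^j d_j X^i,
     (L_X a)_i = X(a_i) + a_j d_i X^j,
     (L_X mu)(v_1, .., v_n) = X(mu(v_1, .., v_n))
                              + sum_k mu(v_1, .., v_k^j d_j X, .., v_n),
   where on the last line the v_k have constant components. *)
Definition lie_bracket (X Y : vfield) : vfield := fun p =>
  \col_i act X (fun q => vfield_in (chart_at p) Y q i 0) p - jacv X p *m Y p.
Definition lie_oneform (X : vfield) (a : oneform) : oneform := fun p =>
  \row_i act X (fun q => oneform_in (chart_at p) a q 0 i) p + a p *m jacv X p.
Definition lie_topform (X : vfield) (mu : topform) : topform := fun p v =>
  act X (fun q => topform_in (chart_at p) mu q v) p
  + \sum_k mu p (fun l => if l == k then jacv X p *m v k else v l).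

Definition is_volume_form (mu : topform) : Prop :=
  [/\ smooth_topform mu,
      forall p k (v : 'I_n -> 'cV[R]_n) (a : R) (x y : 'cV[R]_n),
        mu p (fun l => if l == k then a *: x + y else v l) =
        a * mu p (fun l => if l == k then x else v l)
        + mu p (fun l => if l == k then y else v l),
      forall p (v : 'I_n -> 'cV[R]_n) k l, k != l -> v k = v l -> mu p v = 0 &
      forall p, exists v, mu p v != 0].

(* g = div_mu(X) *)
Definition is_divergence (mu : topform) (X : vfield) g : Prop :=
  forall p v, lie_topform X mu p v = g p * mu p v.

Definition sharp (S : bivfield) (a : oneform) : vfield := fun p => S p *m (a p)^T.

(* pi(a, b) = < b, pi^sharp a > *)
Definition biv_eval (S : bivfield) (a b : oneform) : M -> R :=
  pairing b (sharp S a).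

Definition hamvf (S : bivfield) h : vfield := sharp S (diffl h).

Definition is_hamiltonian (S : bivfield) (X : vfield) : Prop :=
  exists h, smooth h /\ X = hamvf S h.

Definition poisson_bracket (S : bivfield) f g : M -> R :=
  biv_eval S (diffl f) (diffl g).

Definition is_bivector (S : bivfield) : Prop :=
  smooth_bivfield S /\ forall a b p, biv_eval S a b p = - biv_eval S b a p.

Definition is_poisson (S : bivfield) : Prop :=
  is_bivector S /\
  forall f g h, smooth f -> smooth g -> smooth h -> forall p,
    poisson_bracket S f (poisson_bracket S g h) p
    + poisson_bracket S g (poisson_bracket S h f) p
    + poisson_bracket S h (poisson_bracket S f g) p = 0.

(* X(f) = div_mu(X_f) for all smooth f. *)
Definition is_modular_vfield (S : bivfield) (mu : topform) (X : vfield) : Prop :=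
  smooth_vfield X /\
  forall f, smooth f -> is_divergence mu (hamvf S f) (act X f).

Definition end_vfield (N : endfield) (X : vfield) : vfield := fun p => N p *m X p.
Definition end_oneform (N : endfield) (a : oneform) : oneform := fun p => a p *m N p.

(* The bivector field N pi, given by (N pi)^sharp = N o pi^sharp. *)
Definition end_bivfield (N : endfield) (S : bivfield) : bivfield :=
  fun p => N p *m S p.

Definition nijenhuis_torsion (N : endfield) (X Y : vfield) : vfield := fun p =>
  end_vfield N (lie_bracket (end_vfield N X) Y) p
  + end_vfield N (lie_bracket X (end_vfield N Y)) p
  - end_vfield N (end_vfield N (lie_bracket X Y)) p
  - lie_bracket (end_vfield N X) (end_vfield N Y) p.

Definition koszul_bracket (S : bivfield) (a b : oneform) : oneform := fun p =>
  lie_oneform (sharp S a) b p - lie_oneform (sharp S b) a p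
  - diffl (biv_eval S a b) p.

Definition is_poisson_nijenhuis (S0 : bivfield) (N : endfield) : Prop :=
  [/\ is_poisson S0,
      smooth_endfield N,
      forall X Y, smooth_vfield X -> smooth_vfield Y ->
        forall p, nijenhuis_torsion N X Y p = 0,
      forall a p, end_vfield N (sharp S0 a) p = sharp S0 (end_oneform N a) p &
      forall a b, smooth_oneform a -> smooth_oneform b -> forall p,
        koszul_bracket (end_bivfield N S0) a b p =
        koszul_bracket S0 (end_oneform N a) b p
        + koszul_bracket S0 a (end_oneform N b) p
        - end_oneform N (koszul_bracket S0 a b) p].

(* X_N = X^1 - N X^0, for X^0 and X^1 the modular vector fields of pi_0 and
   N pi_0 relative to a common volume form. *)
Definition pn_modular_vfield (N : endfield) (X0 X1 : vfield) : vfield :=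
  fun p => X1 p - N p *m X0 p.

(* N^i for an integer i; Negz m stands for -(m + 1). *)
Definition end_powz (N : endfield) (i : int) : endfield := fun p =>
  match i with
  | Posz m => N p ^+ m
  | Negz m => invmx (N p) ^+ m.+1
  end.

Definition pi_ (S0 : bivfield) (N : endfield) (i : int) : bivfield :=
  end_bivfield (end_powz N i) S0.

Definition h_ (N : endfield) (i : int) : M -> R := fun p =>
  if i == 0 then - (2^-1 * ln `|\det (N p)|)
  else - ((2 * i%:~R)^-1 * \tr (end_powz N i p)).

End Manifold.

Arguments vfield {R n} M.
Arguments oneform {R n} M.
Arguments endfield {R n} M.
Arguments bivfield {R n} M.
Arguments topform {R n} M.

(* Main.v *)
Require Import Defs.
From HB Require Import structures.
From mathcomp Require Import all_boot all_order all_algebra.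
From mathcomp Require Import all_classical all_reals all_analysis.
From mathcomp Require Import perm ring lra zify.

Set Implicit Arguments.
Unset Strict Implicit.
Unset Printing Implicit Defensive.

Import Order.TTheory GRing.Theory Num.Theory.
Import numFieldNormedType.Exports.

Local Open Scope classical_set_scope.
Local Open Scope ring_scope.

(** Work at a point p, in the coordinates x_1, ..., x_n of the chart at p. Let S
    be the matrix of pi_0^sharp, N the matrix of the endomorphism field, and
    write d_a for the partial derivatives at p. Everything reduces to two
    identities between the first derivatives of N and S.

    The first one comes from the torsion. For coordinate vector fields, its
    vanishing reads N (d_a N) - D_(N e_a) N = N J - J N, where J is the matrix
    of the partial derivatives of the field N e_a. Multiplied by a matrix Q that
    commutes with N, the commutator on the right has trace 0, and
    sum_j N_ja tr(Q d_j N) = tr(Q N d_a N) (lenard_trace). On the other hand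
    d_a h_i = - tr(N^(i-1) d_a N) / 2 for every integer i (diffl_h): the
    logarithm of |det N| is what makes i = 0 fit the formula. With Q = N^(i-1)
    this gives dh_(i+1) = N^* dh_i, so dh_i is the i-th power of N^* applied to dh_0, and
    pi_i^sharp dh_j = N^(i+j) pi_0^sharp dh_0, since pi_0^sharp intertwines N^*
    and N (hamvf_pi). So X_k = pi_0^sharp dh_k is the required hierarchy.

    The second one identifies X_N with pi_0^sharp dh_1. Let X_f be the
    hamiltonian vector field of f. As the divergence of g X_f is
    g div(X_f) + X_f(g), the volume form drops out of the difference of the two
    modular vector fields, and the k-th component of X_N is
    sum_ij S_ji d_j N_ki (pn_modular_coord). Contracting the compatibility of
    the brackets of 1-forms, evaluated on dx_a and dx_b, and using the
    derivative of the identity N S = S N^T, one finds that this sum is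
    - sum_j S_kj d_j(tr N) / 2 (koszul_trace), which is the k-th component of
    pi_0^sharp dh_1.

    Since the hypotheses are about globally defined smooth fields, coordinate
    fields, forms and functions at p are first extended to the manifold by
    means of bump functions (extend_vfield, extend_oneform, extend_coord). This,
    and the independence of the chart of the components of tensors, rests on
    the calculus of functions all of whose iterated partial derivatives exist
    and are continuous: such functions are differentiable (C1_differentiable),
    whence the chain rule, and they are stable under the usual operations. *)

(** * From partial derivatives to the differential *)

Section Lines.
Context {R : realType} {V W : normedModType R}.

(** Reduces a directional derivative to the derivative of a function of one real
    variable, for which derivability and differentiability coincide. *)
Lemma is_derive_lineP (f : V -> W) (x v : V) (d : W) :
  is_derive x v f d <-> is_derive (0 : R) 1 (fun t : R => f (t *: v + x)) d.
Proof.
have Ef : (fun h : R => h^-1 *: (f (h *: v + x) - f x)) =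
  (fun h : R => h^-1 *: (f ((h *: (1 : R) + (0 : R)) *: v + x) - f ((0 : R) *: v + x))).
  by apply/funext => h; rewrite addr0 scale0r add0r /GRing.scale/= mulr1.
split=> -[df <-]; split.
- by move: df; rewrite /derivable/= Ef.
- by rewrite /derive/= Ef.
- by rewrite /derivable/= Ef.
- by rewrite /derive/= Ef.
Qed.

End Lines.

Lemma is_derive_comp_scalar (R : realType) (V : normedModType R) (g : R -> R)
    (f : V -> R) (x v : V) (d g' : R) :
  is_derive x v f d -> is_derive (f x) 1 g g' ->
  is_derive x v (fun y => g (f y)) (g' * d).
Proof.
move=> /is_derive_lineP df dg; apply/is_derive_lineP.
have dg0 : is_derive (f ((0 : R) *: v + x)) 1 g g' by rewrite scale0r add0r.
exact: is_derive1_comp dg0 df.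
Qed.

Section PartialDerivatives.
Context {R : realType} {n : nat}.
Implicit Types (f g : 'rV[R]_n -> R) (x y h : 'rV[R]_n).

Lemma is_derive_axis f x y i (s : R) : y = s *: delta_mx 0 i + x ->
  derivable f y (delta_mx 0 i) ->
  is_derive s 1 (fun t : R => f (t *: delta_mx 0 i + x)) (partial i f y).
Proof.
move=> -> df.
have E : (fun h : R => h^-1 *: (f ((h *: 1 + s) *: delta_mx 0 i + x) -
    f (s *: delta_mx 0 i + x))) =
  (fun h : R => h^-1 *: (f (h *: delta_mx 0 i + (s *: delta_mx 0 i + x)) -
    f (s *: delta_mx 0 i + x))).
  by apply/funext => h /=; rewrite scalerDl -addrA /GRing.scale/= mulr1.
split; first by rewrite /derivable/= E; exact: df.
by rewrite /partial /derive /= E.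
Qed.

Lemma axis_increment_le f x i (t e : R) :
  (forall s : R, `|s| <= `|t| ->
     derivable f (s *: delta_mx 0 i + x) (delta_mx 0 i) /\
     `|partial i f (s *: delta_mx 0 i + x)| <= e) ->
  `|f (t *: delta_mx 0 i + x) - f x| <= e * `|t|.
Proof.
move=> H.
pose phi s := f (s *: delta_mx 0 i + x).
have phi0 : f x = phi 0 by rewrite /phi scale0r add0r.
rewrite phi0 -/(phi t).
have key (a b : R) : a <= b -> (forall s : R, s \in `[a, b] -> `|s| <= `|t|) ->
    `|phi b - phi a| <= e * (b - a).
  move=> ab sab.
  have D s : s \in `[a, b] -> is_derive s 1 phi (partial i f (s *: delta_mx 0 i + x)).
    by move=> /sab /H[d _]; exact: is_derive_axis.
  have D' s : s \in `]a, b[ -> is_derive s 1 phi (partial i f (s *: delta_mx 0 i + x)).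
    by move=> /subset_itv_oo_cc /D.
  have C : {within `[a, b], continuous phi}.
    by apply: derivable_within_continuous => s /D [].
  have [c cab ->] := MVT_segment ab D' C.
  by rewrite normrM (ger0_norm (_ : 0 <= b - a)) ?subr_ge0// ler_wpM2r ?subr_ge0//
     (H _ (sab _ cab)).2.
have [t0|t0] := leP 0 t.
  rewrite (ger0_norm t0) -[X in e * X]subr0; apply: key => // s.
  by rewrite in_itv/= => /andP[s0 st]; rewrite (ger0_norm s0) (ger0_norm t0).
rewrite (ltr0_norm t0) distrC -[X in e * X]sub0r; apply: key; first exact: ltW.
move=> s; rewrite in_itv/= => /andP[st s0].
by rewrite (ler0_norm s0) (ltr0_norm t0) lerN2.
Qed.

(** Changing the coordinates of x into those of h + x one at a time goes through
    the points trunc_row k h + x, so that each step is parallel to an axis. *)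
Definition trunc_row (k : nat) h : 'rV[R]_n := \row_j (if (j < k)%N then h 0 j else 0).

Lemma trunc_rowS h (k : 'I_n) :
  trunc_row k.+1 h = h 0 k *: delta_mx 0 k + trunc_row k h.
Proof.
apply/rowP => j; rewrite !mxE eqxx /= ltnS leq_eqVlt.
case: (altP (j =P k)) => [->|jk]; first by rewrite eqxx/= ltnn addr0 mulr1.
by rewrite -(inj_eq val_inj) in jk; rewrite (negbTE jk)/= mulr0 add0r.
Qed.

Lemma row_norm_coord h j : `|h 0 j| <= `|h|.
Proof.
rewrite [leRHS]/Num.Def.normr/= mx_normrE.
exact: (le_bigmax _ (fun ij : 'I_1 * 'I_n => `|h ij.1 ij.2|) (0, j)).
Qed.

Lemma row_norm_le h (e : R) : 0 <= e -> (forall j, `|h 0 j| <= e) -> `|h| <= e.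
Proof.
move=> e0 H; rewrite [leLHS]/Num.Def.normr/= mx_normrE bigmax_le// => -[i j] _ /=.
by rewrite ord1.
Qed.

Lemma row_norm_lt h (e : R) : 0 < e -> (forall j, `|h 0 j| < e) -> `|h| < e.
Proof.
move=> e0 H; rewrite [ltLHS]/Num.Def.normr/= mx_normrE bigmax_lt// => -[i j] _ /=.
by rewrite ord1.
Qed.

(** Sum of the increments along the axes. In the maximum norm, the intermediate
    points stay in the ball. *)
Lemma increment_le f x (d e : R) : 0 < d ->
  (forall y, `|y - x| < d -> forall i, derivable f y (delta_mx 0 i) /\
     `|partial i f y| <= e) ->
  forall h, `|h| < d -> `|f (h + x) - f x| <= n%:R * e * `|h|.
Proof.
move=> d0 H h hd.
have key k : (k <= n)%N -> `|f (trunc_row k h + x) - f x| <= k%:R * e * `|h|.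
  elim: k => [_|k IH kn].
    rewrite (_ : trunc_row 0 h = 0) ?add0r ?subrr ?normr0 ?mul0r//.
    by apply/rowP => j; rewrite !mxE.
  rewrite -[k.+1]/(Ordinal kn : nat).+1 trunc_rowS /=.
  rewrite -[_ - f x](subrKA (f (trunc_row k h + x))).
  rewrite (le_trans (ler_normD _ _))// -natr1 !mulrDl addrC lerD ?IH 1?ltnW//.
  rewrite mul1r -addrA.
  have kx s : `|s| <= `|h 0 (Ordinal kn)| ->
      `|s *: delta_mx 0 (Ordinal kn) + (trunc_row k h + x) - x| < d.
    move=> sh; rewrite addrA addrK; apply: le_lt_trans hd.
    apply: row_norm_le => // j; rewrite !mxE eqxx/=.
    case: (altP (j =P Ordinal kn)) => [->|jk] /=.
      by rewrite ltnn addr0 mulr1 (le_trans sh)// row_norm_coord.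
    by rewrite mulr0 add0r; case: ifP => _; rewrite ?normr0 ?row_norm_coord.
  apply: le_trans (_ : e * `|h 0 (Ordinal kn)| <= _).
    by apply: axis_increment_le => s /kx /H.
  rewrite ler_wpM2l ?row_norm_coord//.
  have := (H x); rewrite subrr normr0 => /(_ d0 (Ordinal kn)) [_].
  exact: le_trans.
have := key n (leqnn n); rewrite (_ : trunc_row n h = h)//.
by apply/rowP => j; rewrite mxE ltn_ord.
Qed.

Definition grad f x : 'cV[R]_n := \col_j partial j f x.

(** Subtracting from f its candidate differential at x leaves a function with
    small partial derivatives near x, to which increment_le applies. *)
Lemma C1_differentiable f x :
  (\forall y \near x, forall i, derivable f y (delta_mx 0 i)) ->
  (forall i, {for x, continuous (partial i f)}) ->
  differentiable f x /\ forall h, 'd f x h = (h *m grad f x) 0 0.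
Proof.
move=> df cf.
pose L h : R^o := (h *m grad f x) 0 0.
have Llin : linear L by move=> a u v; rewrite /L mulmxDl -scalemxAl !mxE.
pose scallM := GRing.isLinear.Build _ _ _ _ _ Llin.
pose scalL : {linear _ -> _} := HB.pack L scallM.
have LE h : L h = \sum_j h 0 j * partial j f x.
  by rewrite /L mxE; apply: eq_bigr => j _; rewrite mxE.
have Lcont : continuous L.
  rewrite (_ : L = fun h => \sum_j h 0 j * partial j f x); last exact/funext.
  apply: continuous_big => [|j _ h]; first exact: add_continuous.
  have c1 : {for h, continuous (fun u : 'rV[R]_n => u 0 j)} by exact: coord_continuous.
  exact: (continuousM c1 (@cst_continuous _ _ (partial j f x) h)).
have Ld i y : is_derive y (delta_mx 0 i) L (partial i f x).
  have dL : differentiable L y by exact: (@linear_differentiable _ _ _ scalL).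
  apply: DeriveDef; first exact: diff_derivable.
  rewrite deriveE// (_ : 'd L y = scalL :> (_ -> _)).
    rewrite /= LE (bigD1 i)//= big1 ?mxE ?eqxx ?addr0 ?mul1r// => j ji.
    by rewrite mxE (negbTE ji) andbF mul0r.
  exact: (@diff_lin _ _ _ scalL).
have fL : (f : _ -> R^o) \o shift x =
    cst (f x : R^o) + (scalL : _ -> R^o) +o_ (0 : 'rV[R]_n) id.
  apply/eqaddoP => e e0.
  pose e' := e / n.+1%:R.
  have e'0 : 0 < e' by rewrite divr_gt0.
  have : \forall y \near x, forall i, derivable f y (delta_mx 0 i) /\
      `|partial i f y - partial i f x| <= e'.
    near=> y; move=> i; split; first by move: i; near: y.
    move: i; near: y; apply: filter_forall => i.
    by have /cvgrPdistC_le := cf i; exact.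
  move=> /nbhs_ballP[d /= d0 dxy].
  apply/nbhs_ballP; exists d => //= h; rewrite -ball_normE/= sub0r normrN => hd.
  rewrite /shift/= !fctE opprD addrA.
  pose g := f - L.
  have -> : f (h + x) - f x - L h = g (h + x) - g x.
    rewrite /g !fctE /L mulmxDl [X in _ = _ - X - _]mxE.
    by lra.
  apply: le_trans (_ : n%:R * e' * `|h| <= _).
    apply: (increment_le d0) => // y; rewrite -normrN opprB => yd i.
    have := dxy y; rewrite -ball_normE/= => /(_ yd i)[dfi ei].
    have dg : is_derive y (delta_mx 0 i) g (partial i f y - partial i f x).
      by apply: is_deriveB; exact: derivableP.
    by split; [exact: ex_derive| rewrite /partial derive_val].
  rewrite ler_wpM2r// /e' mulrA ler_pdivrMr// [leRHS]mulrC ler_wpM2r ?ltW//.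
  by rewrite ltr_nat.
have dE : 'd f x = L :> (_ -> _) by exact: (diff_unique (df := scalL)).
split; last by move=> h; rewrite dE.
apply/diff_locallyP; rewrite dE; split; first exact: Lcont.
exact: fL.
Unshelve. all: by end_near. Qed.

End PartialDerivatives.

Section ChainRule.
Context {R : realType} {m n : nat}.

Lemma row_continuous (T : topologicalType) (g : T -> 'rV[R]_m) (x : T) :
  (forall j, {for x, continuous (fun y => g y 0 j)}) -> {for x, continuous g}.
Proof.
move=> cg; apply/cvgrPdist_lt => e e0; near=> y.
apply: row_norm_lt => // j; rewrite !mxE; move: j; near: y.
by apply: filter_forall => j; have /cvgrPdist_lt := cg j; exact.
Unshelve. all: by end_near. Qed.

Lemma is_derive_comp_row (f : 'rV[R]_m -> R) (g : 'rV[R]_n -> 'rV[R]_m) x v :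
  (\forall y \near g x, forall j, derivable f y (delta_mx 0 j)) ->
  (forall j, {for g x, continuous (partial j f)}) ->
  (forall j, derivable (fun y => g y 0 j) x v) ->
  is_derive x v (f \o g) (\sum_j partial j f (g x) * 'D_v (fun y => g y 0 j) x).
Proof.
move=> df cf dg.
have dgx : derivable g x v.
  by apply: (derivable_mxP g x v).2 => i j; rewrite ord1.
have [dfx dfE] := C1_differentiable df cf.
apply/is_derive_lineP.
pose gam (t : R) := g (t *: v + x).
have gam0 : g x = gam 0 by rewrite /gam scale0r add0r.
have [dgam gamE] := (is_derive_lineP g x v _).1 (derivableP dgx).
have dgamd : differentiable gam (0 : R) by exact: ((derivable1_diffP gam 0).1 dgam).
have dfg0 : differentiable f (gam (0 : R)) by rewrite -gam0.
have dfg : differentiable (f \o gam) (0 : R) by exact: differentiable_comp.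
have gE : 'd gam (0 : R) (1 : R) = 'D_v g x.
  by rewrite -gamE; apply/esym; exact: (deriveE (1 : R^o) dgamd).
split; first exact: ((derivable1_diffP (f \o gam) 0).2 dfg).
transitivity ('d (f \o gam) (0 : R) (1 : R)); first exact: (deriveE (1 : R^o) dfg).
rewrite (diff_comp dgamd dfg0) /=.
move: dfg0 gE; clearbody gam; rewrite -gam0 => dfg0 ->.
rewrite dfE (derive_mx dgx) mxE; apply: eq_bigr => j _.
by rewrite !mxE mulrC.
Qed.

End ChainRule.

(** * Stability of smooth functions under the usual operations *)

Section SmoothFunctions.
Context {R : realType} {n : nat}.
Implicit Types (U V : set 'rV[R]_n) (f g : 'rV[R]_n -> R).

Lemma partial_near_eq i f g x : {near x, f =1 g} -> partial i f x = partial i g x.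
Proof. exact: near_eq_derive. Qed.

Lemma near_eq_continuous f g x : {near x, f =1 g} ->
  {for x, continuous f} -> {for x, continuous g}.
Proof.
move=> fg cf; have E : f x = g x := nbhs_singleton fg.
suff : g y @[y --> x] --> f x by rewrite E.
exact: cvg_trans (@near_eq_cvg _ _ (nbhs x) _ f g fg) cf.
Qed.

Lemma smooth_continuous U f x : smooth_on U f -> U x -> {for x, continuous f}.
Proof. by move=> sf Ux; have [] := sf [::] x Ux. Qed.

Lemma smooth_derivable U f x i :
  smooth_on U f -> U x -> derivable f x (delta_mx 0 i).
Proof. by move=> sf Ux; have [_] := sf [::] x Ux; exact. Qed.

Lemma smooth_partial U f i : smooth_on U f -> smooth_on U (partial i f).
Proof.
by move=> sf s x Ux; have := sf (rcons s i) x Ux; rewrite /iter_partial foldr_rcons.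
Qed.

Lemma smooth_subset U V f : V `<=` U -> smooth_on U f -> smooth_on V f.
Proof. by move=> VU sf s x /VU; exact: sf. Qed.

Lemma smooth_local U f :
  (forall x, U x -> exists V, V x /\ smooth_on V f) -> smooth_on U f.
Proof. by move=> H s x /H[V [Vx sf]]; exact: sf. Qed.

Lemma open_near_eq U f g x : open U -> U x ->
  (forall y, U y -> f y = g y) -> {near x, f =1 g}.
Proof. by move=> oU Ux fg; near=> y; apply: fg; near: y; exact: open_nbhs_nbhs.
Unshelve. all: by end_near. Qed.

(** To show that functions are smooth, it is enough to put them in a class whose
    members are continuous and have their partial derivatives in the class: no
    formula for the iterated derivatives is needed. *)
Lemma smooth_coind U (F : set ('rV[R]_n -> R)) : open U ->
  (forall f x, F f -> U x ->
     {for x, continuous f} /\ forall i, derivable f x (delta_mx 0 i)) ->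
  (forall f i, F f -> exists2 g, F g & forall x, U x -> partial i f x = g x) ->
  forall f, F f -> smooth_on U f.
Proof.
move=> oU F1 F2 f Ff s x Ux.
have [g Fg fg] : exists2 g, F g & forall x, U x -> iter_partial s f x = g x.
  elim: s => [|i s [g Fg fg]] /=; first by exists f.
  have [h Fh gh] := F2 g i Fg; exists h => // y Uy.
  rewrite -gh//; apply: partial_near_eq; exact: open_near_eq fg.
have [cg dg] := F1 g x Fg Ux.
have nfg : {near x, g =1 iter_partial s f}.
  by apply: (open_near_eq oU Ux) => y Uy; rewrite fg.
split=> [|i]; last exact: near_eq_derivable nfg (dg i).
exact: near_eq_continuous nfg cg.
Qed.

Lemma smooth_eq U f g : open U -> (forall x, U x -> f x = g x) ->
  smooth_on U f -> smooth_on U g.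
Proof.
move=> oU fg sf.
pose F : set ('rV[R]_n -> R) :=
  [set h | exists2 k, smooth_on U k & forall x, U x -> k x = h x].
apply: (@smooth_coind U F oU); last by exists f.
- move=> h x [k sk kh] Ux.
  have nkh : {near x, k =1 h} by exact: open_near_eq kh.
  split=> [|i]; last first.
    exact: near_eq_derivable nkh (smooth_derivable sk Ux).
  exact: near_eq_continuous nkh (smooth_continuous sk Ux).
- move=> h i [k sk kh]; exists (partial i k).
    by exists (partial i k); first exact: smooth_partial.
  move=> x Ux; apply/esym/partial_near_eq; exact: open_near_eq kh.
Qed.

Lemma smooth_cst U (c : R) : smooth_on U (fun=> c).
Proof.
move=> s x Ux.
suff [d ->] : exists d, iter_partial s (fun=> c) = (fun=> d) :> ('rV[R]_n -> R).
  by split; [exact: cst_continuous|move=> i; exact: derivable_cst].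
elim: s => [|i s [d IH]]; first by exists c.
by exists 0 => /=; rewrite IH; apply/funext => y; exact: derive_cst.
Qed.

(** The class to which smooth_coind is applied. The chain rule expresses the
    partial derivatives of f \o g by sums, products and compositions with g, so
    that composition can only be treated together with sums and products. *)
Inductive smooth_gen U : ('rV[R]_n -> R) -> Prop :=
| gen_base f of smooth_on U f : smooth_gen U f
| gen_add f g of smooth_gen U f & smooth_gen U g : smooth_gen U (fun x => f x + g x)
| gen_mul f g of smooth_gen U f & smooth_gen U g : smooth_gen U (fun x => f x * g x)
| gen_comp m (V : set 'rV[R]_m) (f : 'rV[R]_m -> R) (g : 'rV[R]_n -> 'rV[R]_m) of
    open V & smooth_on V f & (forall x, U x -> V (g x)) &
    (forall j, smooth_on U (fun x => g x 0 j)) : smooth_gen U (f \o g).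

Lemma gen_sum U I (r : seq I) (F : I -> 'rV[R]_n -> R) :
  (forall i, smooth_gen U (F i)) -> smooth_gen U (fun x => \sum_(i <- r) F i x).
Proof.
move=> HF; elim: r => [|i r IH].
  rewrite (_ : (fun=> _) = fun=> 0); last by apply/funext => x; rewrite big_nil.
  exact/gen_base/smooth_cst.
rewrite (_ : (fun=> _) = fun x => F i x + \sum_(i <- r) F i x).
  exact: gen_add.
by apply/funext => x; rewrite big_cons.
Qed.

Lemma comp_row_is_derive m (V : set 'rV[R]_m) (f : 'rV[R]_m -> R)
    (g : 'rV[R]_n -> 'rV[R]_m) x v : open V -> smooth_on V f ->
  V (g x) -> (forall j, derivable (fun x => g x 0 j) x v) ->
  is_derive x v (f \o g) (\sum_j partial j f (g x) * 'D_v (fun y => g y 0 j) x).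
Proof.
move=> oV sf Vx dg; apply: is_derive_comp_row; last exact: dg.
- near=> y; move=> j.
  have Vy : V y by near: y; exact: open_nbhs_nbhs.
  by have [_] := sf [::] y Vy; exact.
- by move=> j; have [] := sf [:: j] _ Vx.
Unshelve. all: by end_near. Qed.

Lemma gen_C1 U f x : open U -> smooth_gen U f -> U x ->
  {for x, continuous f} /\ forall i, derivable f x (delta_mx 0 i).
Proof.
move=> oU gf Ux.
elim: gf => {f} [f sf|f g _ [cf df] _ [cg dg]|f g _ [cf df] _ [cg dg]|m V f g oV sf UV sg].
- by split=> [|i]; [exact: smooth_continuous sf Ux|exact: smooth_derivable sf Ux].
- by split=> [|i]; [exact: continuousD|exact: derivableD].
- by split=> [|i]; [exact: continuousM|exact: derivableM].
- split=> [|i].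
    apply: continuous_comp.
      by apply: row_continuous => j; exact: smooth_continuous (sg j) Ux.
    by have [] := sf [::] (g x) (UV x Ux).
  apply: ex_derive; apply: (comp_row_is_derive oV sf (UV x Ux)) => j.
  exact: smooth_derivable (sg j) Ux.
Qed.

Lemma gen_partial U f i : open U -> smooth_gen U f ->
  exists2 g, smooth_gen U g & forall x, U x -> partial i f x = g x.
Proof.
move=> oU.
elim=> {f} [f sf|f g gf [f' gf' ff'] gg [g' gg' gg'E]|f g gf [f' gf' ff'] gg [g' gg' gg'E]
  |m V f g oV sf UV sg].
- by exists (partial i f) => //; exact/gen_base/smooth_partial.
- exists (fun x => f' x + g' x); first exact: gen_add.
  move=> x Ux; rewrite -ff'// -gg'E//; apply: deriveD.
    by have [] := gen_C1 oU gf Ux.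
  by have [] := gen_C1 oU gg Ux.
- exists (fun x => f x * g' x + g x * f' x).
    by apply: gen_add; exact: gen_mul.
  move=> x Ux; rewrite -ff'// -gg'E//; apply: deriveM.
    by have [] := gen_C1 oU gf Ux.
  by have [] := gen_C1 oU gg Ux.
- exists (fun x => \sum_j (partial j f \o g) x * partial i (fun y => g y 0 j) x).
    apply: gen_sum => j; apply: gen_mul.
      apply: (gen_comp oV _ UV sg) => s y Vy.
      by have := sf (rcons s j) y Vy; rewrite /iter_partial foldr_rcons.
    exact/gen_base/smooth_partial.
  move=> x Ux.
  have dg j : derivable (fun x => g x 0 j) x (delta_mx 0 i) by exact: smooth_derivable (sg j) Ux.
  by have [_] := comp_row_is_derive oV sf (UV x Ux) dg.
Qed.

Lemma gen_smooth U f : open U -> smooth_gen U f -> smooth_on U f.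
Proof.
move=> oU; apply: (smooth_coind oU (F := smooth_gen U)).
- by move=> g x gg Ux; exact: gen_C1 gg Ux.
- by move=> g i gg; exact: gen_partial.
Qed.

Lemma smoothD U f g : open U -> smooth_on U f -> smooth_on U g ->
  smooth_on U (fun x => f x + g x).
Proof. by move=> oU sf sg; apply: (gen_smooth oU); apply: gen_add; exact: gen_base. Qed.

Lemma smoothM U f g : open U -> smooth_on U f -> smooth_on U g ->
  smooth_on U (fun x => f x * g x).
Proof. by move=> oU sf sg; apply: (gen_smooth oU); apply: gen_mul; exact: gen_base. Qed.

Lemma smoothB U f g : open U -> smooth_on U f ->
  smooth_on U g -> smooth_on U (fun x => f x - g x).
Proof.
move=> oU sf sg.
rewrite (_ : (fun=> _) = fun x => f x + (-1) * g x).
  by apply: (smoothD oU sf); apply: (smoothM oU _ sg); exact: smooth_cst.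
by apply/funext => x; rewrite mulN1r.
Qed.

Lemma smooth_comp U m (V : set 'rV[R]_m) (f : 'rV[R]_m -> R) (g : 'rV[R]_n -> 'rV[R]_m) :
  open U -> open V -> smooth_on V f -> (forall x, U x -> V (g x)) ->
  (forall j, smooth_on U (fun x => g x 0 j)) -> smooth_on U (f \o g).
Proof. by move=> oU oV sf UV sg; apply: gen_smooth oU _; exact: gen_comp oV sf UV sg. Qed.

Lemma smooth_coord U (i : 'I_n) : open U -> smooth_on U (fun x : 'rV[R]_n => x 0 i).
Proof.
move=> oU.
pose F : set ('rV[R]_n -> R) :=
  [set f | (exists c, f = fun=> c) \/ f = fun x : 'rV[R]_n => x 0 i].
apply: (@smooth_coind U F oU); last by right.
- move=> f x /= [[c ->]|->] Ux.
    by split=> [|j]; [exact: cst_continuous|exact: derivable_cst].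
  split; first exact: coord_continuous.
  by move=> j; apply: diff_derivable; exact: differentiable_coord.
- move=> f j /= [[c ->]|->].
    by exists (fun=> 0); [left; exists 0|move=> x _; exact: derive_cst].
  exists (fun=> delta_mx (0 : 'I_1) j 0 i); first by left; eexists.
  move=> x _; rewrite /partial.
  have := derive_id x (delta_mx (0 : 'I_1) j : 'rV[R]_n).
  rewrite derive_mx; last exact: derivable_id.
  by move=> /matrixP/(_ 0 i); rewrite mxE.
Qed.

Lemma smooth_sum U I (r : seq I) (F : I -> 'rV[R]_n -> R) : open U ->
  (forall i, smooth_on U (F i)) -> smooth_on U (fun x => \sum_(i <- r) F i x).
Proof. by move=> oU sF; apply: (gen_smooth oU); apply: gen_sum => i; exact: gen_base. Qed.

Lemma smooth_prod U I (r : seq I) (F : I -> 'rV[R]_n -> R) : open U ->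
  (forall i, smooth_on U (F i)) -> smooth_on U (fun x => \prod_(i <- r) F i x).
Proof.
move=> oU HF; elim: r => [|i r IH].
  rewrite (_ : (fun=> _) = fun=> 1); last by apply/funext => x; rewrite big_nil.
  exact: smooth_cst.
rewrite (_ : (fun=> _) = fun x => F i x * \prod_(i <- r) F i x).
  by apply: (smoothM oU); [exact: HF|exact: IH].
by apply/funext => x; rewrite big_cons.
Qed.

End SmoothFunctions.

(** * Functions of one variable and bump functions *)

Section OneVariable.
Context {R : realType}.
Implicit Types (D : set R) (f g : R -> R) (P Q : {poly R}).

Lemma open_row1 D : open D -> open [set y : 'rV[R]_1 | D (y 0 0)].
Proof.
move=> oD; apply: (@open_comp _ _ (fun y : 'rV[R]_1 => y 0 0)) => //.
by move=> y _; exact: coord_continuous.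
Qed.

(** A function of one variable is seen as a function on 'rV_1, so that composition
    with it is a case of smooth_comp. *)
Lemma smooth_coind1 D (F : set (R -> R)) : open D ->
  (forall f, F f -> exists2 g, F g & forall x, D x -> is_derive x 1 f (g x)) ->
  forall f, F f ->
  smooth_on [set y : 'rV[R]_1 | D (y 0 0)] (fun y => f (y 0 0)).
Proof.
move=> oD HF f Ff.
pose G : set ('rV[R]_1 -> R) := [set k | exists2 f, F f & k = fun y : 'rV[R]_1 => f (y 0 0)].
have key (g : R -> R) (g' : R) (y : 'rV[R]_1) (i : 'I_1) : is_derive (y 0 0) 1 g g' ->
    is_derive y (delta_mx 0 i) (fun y : 'rV[R]_1 => g (y 0 0)) g'.
  move=> [dg gE].
  have E : (fun h : R => h^-1 *: (g ((h *: delta_mx 0 i + y) 0 0) - g (y 0 0))) =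
      (fun h : R => h^-1 *: (g (h *: 1 + y 0 0) - g (y 0 0))).
    by apply/funext => h; rewrite !mxE (ord1 i) !eqxx.
  by split; [rewrite /derivable/= E|rewrite /derive/= E -gE].
apply: (@smooth_coind _ _ _ G (open_row1 oD)); last by exists f.
- move=> _ y [g Fg ->] Dy.
  have [g' Fg' gg'] := HF g Fg.
  split; last first.
    by move=> i; have [] := key g (g' (y 0 0)) y i (gg' _ Dy).
  have cg : {for (y 0 0), continuous g}.
    by apply/differentiable_continuous/derivable1_diffP; have [] := gg' _ Dy.
  have cy : {for y, continuous (fun y : 'rV[R]_1 => y 0 0)} by exact: coord_continuous.
  exact: continuous_comp cy cg.
- move=> _ i [g Fg ->].
  have [g' Fg' gg'] := HF g Fg.
  exists (fun y => g' (y 0 0)); first by exists g'.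
  by move=> y Dy; have [_] := key g (g' (y 0 0)) y i (gg' _ Dy).
Qed.

Lemma smooth_comp1 n (U : set 'rV[R]_n) D f (g : 'rV[R]_n -> R) :
  open U -> open D ->
  smooth_on [set y : 'rV[R]_1 | D (y 0 0)] (fun y => f (y 0 0)) ->
  smooth_on U g -> (forall x, U x -> D (g x)) -> smooth_on U (fun x => f (g x)).
Proof.
move=> oU oD sf sg UD.
have -> : (fun x => f (g x)) = (fun y : 'rV[R]_1 => f (y 0 0)) \o (fun x => \row_(_ < 1) g x).
  by apply/funext => x /=; rewrite mxE.
apply: (smooth_comp oU (open_row1 oD) sf) => [x Ux|j] /=.
  by rewrite mxE; exact: UD.
by rewrite (_ : (fun=> _) = g)//; apply/funext => x; rewrite mxE.
Qed.

Lemma near_eq_is_derive1 f g (x d : R) : {near x, f =1 g} ->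
  is_derive x 1 f d -> is_derive x 1 g d.
Proof. exact: near_eq_is_derive. Qed.

Lemma horner_is_derive P (x : R) : is_derive x 1 (horner P) P^`().[x].
Proof.
split; first exact: derivable_horner.
by rewrite -derive1E -derivE.
Qed.

Lemma inv_is_derive (x : R) : x != 0 -> is_derive x 1 (fun y : R => y^-1) (- x^-1 ^+ 2).
Proof.
move=> x0; split; first by apply: derivableV => //; exact: derivable_id.
rewrite (@deriveV _ _ id x 1 x0 (@derivable_id _ _ x 1)).
by rewrite derive_id /GRing.scale/= mulr1 exprVn.
Qed.

Lemma horner_inv_is_derive P (x : R) : x != 0 ->
  is_derive x 1 (fun y : R => P.[y^-1]) (- (P^`() * 'X^2)).[x^-1].
Proof.
move=> x0; rewrite hornerN hornerM hornerXn -mulrN.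
exact: is_derive1_comp (horner_is_derive _ _) (inv_is_derive x0).
Qed.

Lemma open_neq0 : open [set x : R | x != 0].
Proof. exact: open_neq. Qed.

Lemma ln_norm_is_derive (x : R) : x != 0 -> is_derive x 1 (fun y : R => ln `|y|) x^-1.
Proof.
move=> x0; have [xp|xn|xE] := ltgtP 0 x.
- refine (near_eq_is_derive1 (f := @ln R) _ _); last exact: is_derive1_ln.
  by near=> y; rewrite gtr0_norm//; near: y; exact: lt_nbhsr.
- refine (near_eq_is_derive1 (f := @ln R \o -%R) _ _).
    by near=> y => /=; rewrite ltr0_norm//; near: y; exact: lt_nbhsl.
  rewrite -[x^-1]opprK -invrN -mulrN1.
  by apply: is_derive1_comp; apply: is_derive1_ln; rewrite oppr_gt0.
- by rewrite -xE eqxx in x0.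
Unshelve. all: by end_near. Qed.

Section Composed.
Context {n : nat}.
Implicit Type U : set 'rV[R]_n.

(** The polynomials in 1/y contain 1/y and are closed under derivation. *)
Lemma smoothV U (g : 'rV[R]_n -> R) : open U -> smooth_on U g ->
  (forall x, U x -> g x != 0) -> smooth_on U (fun x => (g x)^-1).
Proof.
move=> oU sg g0.
apply: (smooth_comp1 (f := fun y => y^-1) oU open_neq0 _ sg g0).
pose F : set (R -> R) := [set f | exists P : {poly R}, f = fun y => P.[y^-1]].
apply: (@smooth_coind1 _ F open_neq0).
  move=> _ [P ->]; exists (fun y => (- (P^`() * 'X^2)).[y^-1]); first by eexists.
  by move=> x; exact: horner_inv_is_derive.
by exists 'X; apply/funext => y; rewrite hornerX.
Qed.

Lemma smooth_ln_norm U (g : 'rV[R]_n -> R) : open U -> smooth_on U g ->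
  (forall x, U x -> g x != 0) -> smooth_on U (fun x => ln `|g x|).
Proof.
move=> oU sg g0.
apply: (smooth_comp1 (f := fun y : R => ln `|y|) oU open_neq0 _ sg g0).
pose F : set (R -> R) := [set f | (exists P : {poly R}, f = fun y => P.[y^-1]) \/
  f = fun y : R => ln `|y|].
apply: (@smooth_coind1 _ F open_neq0 _ (fun y : R => ln `|y|)); last by right.
move=> f [[P ->]|->].
  exists (fun y => (- (P^`() * 'X^2)).[y^-1]); first by left; eexists.
  by move=> x; exact: horner_inv_is_derive.
exists (fun y => 'X.[y^-1]); first by left; eexists.
by move=> x; rewrite hornerX; exact: ln_norm_is_derive.
Qed.

End Composed.

(** The flat function exp(-1/t) multiplied by polynomials in 1/t, extended by 0 to
    t <= 0. With these factors the family is closed under derivation. *)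
Definition flat P (t : R) : R := if 0 < t then P.[t^-1] * expR (- t^-1) else 0.

Lemma horner_le_expR P : exists2 C, 0 < C & forall u, 0 <= u -> `|P.[u]| <= C * expR u.
Proof.
exists (1 + \sum_(i < size P) `|P`_i| * (i`!)%:R).
  by rewrite ltr_wpDr// sumr_ge0.
move=> u u0; rewrite mulrDl mul1r ler_wpDl ?expR_ge0//.
rewrite horner_coef mulr_suml (le_trans (ler_norm_sum _ _ _))// ler_sum// => i _.
rewrite normrM -mulrA ler_wpM2l// ger0_norm ?exprn_ge0//.
case: (nat_of_ord i) => [|k].
  rewrite expr0 fact0 mul1r; apply: le_trans (expR_ge1Dx u).
  by rewrite lerDl.
have := expR_ge1Dxn k u0; rewrite -ler_pdivrMl ?ltr0n ?fact_gt0// mulrC.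
by apply: le_trans; rewrite lerDr.
Qed.

(** At t = 0 the difference quotient is O(t), as (1/t)^2 P(1/t) exp(-1/t) is
    bounded by horner_le_expR. *)
Lemma flat_is_derive P (t : R) :
  is_derive t 1 (flat P) (flat ('X^2 * (P - P^`())) t).
Proof.
have [tp|tn|tE] := ltgtP 0 t.
- refine (near_eq_is_derive1 (f := fun y => P.[y^-1] * expR (- y^-1)) _ _).
    by near=> y; rewrite /flat ifT//; near: y; exact: lt_nbhsr.
  rewrite /flat tp.
  have t0 : t != 0 by rewrite gt_eqF.
  have d1 := horner_inv_is_derive P t0.
  have d2 : is_derive t 1 (fun y => expR (- y^-1)) (expR (- t^-1) * t^-1 ^+ 2).
    rewrite -[t^-1 ^+ 2]opprK.
    have dV : is_derive t 1 (fun y : R => - y^-1) (- (- t^-1 ^+ 2)).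
      exact: (@is_deriveN _ _ _ (fun y : R => y^-1) t 1 _ (inv_is_derive t0)).
    exact: is_derive1_comp (is_derive_expR _) dV.
  apply: is_derive_eq (is_deriveM d1 d2) _.
  rewrite /GRing.scale/= !(hornerN, hornerM, hornerD, hornerX, hornerXn).
  by ring.
- refine (near_eq_is_derive1 (f := cst 0) _ _).
    near=> y; rewrite /flat ifF//; apply/negbTE; rewrite -leNgt ltW//.
    by near: y; exact: lt_nbhsl.
  rewrite /flat ltNge (ltW tn)/=; exact: is_derive_cst.
- rewrite -tE.
  have -> : flat ('X^2 * (P - P^`())) 0 = 0 by rewrite /flat ltxx.
  have [C C0 HC] := horner_le_expR (P * 'X^2).
  have L : (h^-1 *: (flat P (h *: 1 + 0) - flat P 0)) @[h --> (0 : R)^'] --> (0 : R).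
    apply/cvgrPdist_le => /= e e0; near=> h.
    have hC : `|h| <= e / C.
      rewrite ltW//; near: h; apply: dnbhs0_lt; exact: divr_gt0.
    rewrite sub0r normrN addr0 /flat ltxx subr0 /GRing.scale/= mulr1.
    case: ifPn => [hp|_]; last by rewrite mulr0 normr0 ltW.
    have h0 : h != 0 by rewrite gt_eqF.
    have := HC h^-1; rewrite invr_ge0 (ltW hp) => /(_ isT).
    rewrite !hornerM hornerX -expr2 => H.
    apply: le_trans (_ : C * h <= _); last first.
      by rewrite mulrC -ler_pdivlMr//; rewrite gtr0_norm in hC.
    rewrite !normrM (gtr0_norm (expR_gt0 _)) expRN.
    rewrite mulrA ler_pdivrMr ?expR_gt0//.
    rewrite normrM in H.
    have -> : `|h^-1| * `|P.[h^-1]| = (`|P.[h^-1]| * `|h^-1 ^+ 2|) * h.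
      rewrite !(gtr0_norm (x := h^-1), gtr0_norm (x := h^-1 ^+2)) ?exprn_gt0 ?invr_gt0//.
      by field.
    by rewrite [leRHS]mulrAC ler_pM2r.
  by split; [apply/cvg_ex; exists 0|apply/cvg_lim].
Unshelve. all: by end_near. Qed.

Lemma flat_gt0 (t : R) : 0 < t -> 0 < flat 1 t.
Proof. by move=> t0; rewrite /flat t0 hornerC mul1r expR_gt0. Qed.

Lemma flat_ge0 (t : R) : 0 <= flat 1 t.
Proof. by rewrite /flat; case: ifP => // _; rewrite hornerC mul1r expR_ge0. Qed.

Lemma flat_eq0 P (t : R) : t <= 0 -> flat P t = 0.
Proof. by move=> t0; rewrite /flat ltNge t0. Qed.

Lemma smooth_flat n (U : set 'rV[R]_n) (g : 'rV[R]_n -> R) : open U ->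
  smooth_on U g -> smooth_on U (fun x => flat 1 (g x)).
Proof.
move=> oU sg; apply: (smooth_comp1 (D := setT) oU openT _ sg) => //.
pose F : set (R -> R) := [set f | exists P : {poly R}, f = flat P].
apply: (@smooth_coind1 _ F openT); last by exists 1.
move=> _ [P ->]; exists (flat ('X^2 * (P - P^`()))); first by eexists.
by move=> x _; exact: flat_is_derive.
Qed.

(** With rho the square of the distance to a in units of r/2, the quotient
    flat(2 - rho) / (flat(2 - rho) + flat(rho - 1)) is 1 where rho <= 1 and 0 where
    rho >= 2. Its denominator is positive because 2 - rho or rho - 1 is. *)
Lemma bump_exists n (a : 'rV[R]_n) (r : R) : 0 < r ->
  exists psi : 'rV[R]_n -> R, [/\ smooth_on setT psi,
    \forall x \near a, psi x = 1 & forall x, r <= `|x - a| -> psi x = 0].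
Proof.
move=> r0.
pose rho (x : 'rV[R]_n) : R := \sum_i ((2 / r) * (x 0 i - a 0 i)) ^+ 2.
have srho : smooth_on setT rho.
  apply: (smooth_sum _ openT) => i.
  have s1 : smooth_on setT (fun x : 'rV[R]_n => (2 / r) * (x 0 i - a 0 i)).
    apply: (smoothM openT); first exact: smooth_cst.
    by apply: (smoothB openT); [exact: (smooth_coord i openT)|exact: smooth_cst].
  exact: (smoothM openT s1 s1).
pose den x := flat 1 (2 - rho x) + flat 1 (rho x - 1).
have s2 : smooth_on setT (fun x => flat 1 (2 - rho x)).
  by apply: (smooth_flat openT); apply: (smoothB openT _ srho); exact: smooth_cst.
have s3 : smooth_on setT (fun x => flat 1 (rho x - 1)).
  by apply: (smooth_flat openT); apply: (smoothB openT srho); exact: smooth_cst.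
have den_gt0 x : 0 < den x.
  have [h|h] := ltP (rho x) 2.
    by rewrite ltr_pwDl ?flat_ge0// flat_gt0// subr_gt0.
  rewrite ltr_wpDl ?flat_ge0// flat_gt0// subr_gt0; apply: lt_le_trans h.
  by rewrite ltr1n.
exists (fun x => flat 1 (2 - rho x) * (den x)^-1); split.
- apply: (smoothM openT s2); apply: (smoothV openT); first exact: (smoothD openT s2 s3).
  by move=> x _; rewrite gt_eqF.
- have rhoa : rho a = 0.
    by rewrite /rho big1// => i _; rewrite subrr mulr0 expr0n.
  have crho : {for a, continuous rho} by exact: smooth_continuous srho I.
  have : \forall x \near a, rho x < 1.
    by apply: (cvgr_lt _ crho); rewrite rhoa.
  apply: filterS => x x1.
  rewrite /den (flat_eq0 _ (_ : rho x - 1 <= 0)); last by rewrite subr_le0 ltW.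
  by rewrite addr0 divff// gt_eqF// flat_gt0// subr_gt0 (lt_trans x1)// ltr1n.
- move=> x xr; rewrite flat_eq0 ?mul0r// subr_le0.
  have [i xi] : exists i, r <= `|x 0 i - a 0 i|.
    apply: contrapT => H; move: xr; apply/negP; rewrite -ltNge.
    apply: row_norm_lt => // j; rewrite ltNge; apply/negP => xj.
    by apply: H; exists j; rewrite !mxE in xj.
  rewrite /rho (bigD1 i)//=; apply: ler_wpDr; first by rewrite sumr_ge0// => j _; exact: sqr_ge0.
  rewrite exprMn -(real_normK (num_real (x 0 i - a 0 i))).
  have h1 : r ^+ 2 <= `|x 0 i - a 0 i| ^+ 2 by rewrite ler_pXn2r// ?nnegrE ?ltW.
  apply: le_trans (_ : (2 / r) ^+ 2 * r ^+ 2 <= _); last by rewrite ler_wpM2l// sqr_ge0.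
  rewrite -exprMn divfK ?gt_eqF// expr2 -natrM ler_nat//.
Qed.

End OneVariable.

(** * Calculus of matrix-valued functions *)

Section SmoothMatrices.
Context {R : realType} {n : nat}.
Implicit Types U : set 'rV[R]_n.

Definition smooth_mat U p q (A : 'rV[R]_n -> 'M[R]_(p, q)) :=
  forall i j, smooth_on U (fun x => A x i j).

Lemma smooth_mulmx U p q r (A : 'rV[R]_n -> 'M[R]_(p, q)) (B : 'rV[R]_n -> 'M[R]_(q, r)) :
  open U -> smooth_mat U A -> smooth_mat U B -> smooth_mat U (fun x => A x *m B x).
Proof.
move=> oU sA sB i j.
rewrite (_ : (fun=> _) = fun x => \sum_k A x i k * B x k j).
  by apply: (smooth_sum _ oU) => k; exact: (smoothM oU (sA i k) (sB k j)).
by apply/funext => x; rewrite mxE.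
Qed.

Lemma smooth_trmx U p q (A : 'rV[R]_n -> 'M[R]_(p, q)) :
  smooth_mat U A -> smooth_mat U (fun x => (A x)^T).
Proof.
move=> sA i j; rewrite (_ : (fun=> _) = fun x => A x j i); first exact: sA.
by apply/funext => x; rewrite mxE.
Qed.

Lemma smooth_mxtrace U p (A : 'rV[R]_n -> 'M[R]_p) :
  open U -> smooth_mat U A -> smooth_on U (fun x => \tr (A x)).
Proof. by move=> oU sA; apply: (smooth_sum _ oU) => k; exact: sA. Qed.

Lemma smooth_det U p (A : 'rV[R]_n -> 'M[R]_p) :
  open U -> smooth_mat U A -> smooth_on U (fun x => \det (A x)).
Proof.
move=> oU sA; apply: (smooth_sum _ oU) => s.
apply: (smoothM oU); first exact: smooth_cst.
by apply: (smooth_prod _ oU) => k; exact: sA.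
Qed.

Lemma smooth_invmx U p (A : 'rV[R]_n -> 'M[R]_p) : open U -> smooth_mat U A ->
  (forall x, U x -> A x \in unitmx) -> smooth_mat U (fun x => invmx (A x)).
Proof.
move=> oU sA uA i j.
apply: (@smooth_eq _ _ U (fun x => (\det (A x))^-1 * cofactor (A x) j i) _ oU).
  by move=> x Ux; rewrite /invmx uA// !mxE.
apply: (smoothM oU).
  apply: (smoothV oU); first exact: smooth_det.
  by move=> x /uA; rewrite unitmxE unitfE.
apply: (smoothM oU); first exact: smooth_cst.
apply: smooth_det => // k l.
rewrite (_ : (fun=> _) = fun x => A x (lift j k) (lift i l)); first exact: sA.
by apply/funext => x; rewrite !mxE.
Qed.

Lemma smooth_expmx U p (A : 'rV[R]_n -> 'M[R]_p) k : open U -> smooth_mat U A ->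
  smooth_mat U (fun x => A x ^+ k).
Proof.
move=> oU sA; elim: k => [|k IH].
  by move=> i j; exact: smooth_cst.
rewrite (_ : (fun=> _) = fun x => A x *m (A x ^+ k)); first exact: smooth_mulmx.
by apply/funext => x; rewrite exprS mulmxE.
Qed.

End SmoothMatrices.

Section MatrixDerivatives.
Context {R : realType} {V : normedModType R}.
Implicit Types (x v : V).

Lemma is_derive_bigsum I (r : seq I) (F : I -> V -> R) (D : I -> R) x v :
  (forall i, is_derive x v (F i) (D i)) ->
  is_derive x v (fun y => \sum_(i <- r) F i y) (\sum_(i <- r) D i).
Proof.
move=> HF; elim: r => [|i r IH].
  rewrite big_nil (_ : (fun=> _) = cst 0); first exact: is_derive_cst.
  by apply/funext => y; rewrite big_nil.
rewrite big_cons (_ : (fun=> _) = F i + (fun y => \sum_(i <- r) F i y)).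
  exact: is_deriveD.
by apply/funext => y; rewrite big_cons.
Qed.

Lemma is_deriveM_fun (f g : V -> R) x v (df dg : R) :
  is_derive x v f df -> is_derive x v g dg ->
  is_derive x v (fun y => f y * g y) (df * g x + f x * dg).
Proof.
move=> hf hg; apply: is_derive_eq (is_deriveM hf hg) _.
by rewrite addrC /GRing.scale/= [df * _]mulrC.
Qed.

Lemma is_derive_mx p q (A : V -> 'M[R]_(p, q)) (D : 'M[R]_(p, q)) x v :
  (forall i j, is_derive x v (fun y => A y i j) (D i j)) -> is_derive x v A D.
Proof.
move=> H.
have dA : derivable A x v.
  by apply: (derivable_mxP A x v).2 => i j; have [] := H i j.
split; first exact: dA.
by rewrite (derive_mx dA); apply/matrixP => i j; rewrite mxE; have [_] := H i j.
Qed.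

Lemma is_derive_entry p q (A : V -> 'M[R]_(p, q)) (D : 'M[R]_(p, q)) x v i j :
  is_derive x v A D -> is_derive x v (fun y => A y i j) (D i j).
Proof.
move=> [dA <-]; split; first exact: ((derivable_mxP A x v).1 dA i j).
by rewrite (derive_mx dA) mxE.
Qed.

Lemma is_derive_mulmx p q r (A : V -> 'M[R]_(p, q)) (B : V -> 'M[R]_(q, r)) D E x v :
  is_derive x v A D -> is_derive x v B E ->
  is_derive x v (fun y => A y *m B y) (D *m B x + A x *m E).
Proof.
move=> dA dB; apply: is_derive_mx => i j.
rewrite (_ : (fun=> _) = fun y => \sum_k A y i k * B y k j); last first.
  by apply/funext => y; rewrite mxE.
rewrite !mxE -big_split /=; apply: is_derive_bigsum => k.
by apply: is_deriveM_fun; exact: is_derive_entry.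
Qed.

Lemma is_derive_trmx p q (A : V -> 'M[R]_(p, q)) D x v :
  is_derive x v A D -> is_derive x v (fun y => (A y)^T) D^T.
Proof.
move=> dA; apply: is_derive_mx => i j.
rewrite mxE (_ : (fun=> _) = fun y => A y j i); first exact: is_derive_entry.
by apply/funext => y; rewrite mxE.
Qed.

Lemma is_derive_mxtrace p (A : V -> 'M[R]_p) D x v :
  is_derive x v A D -> is_derive x v (fun y => \tr (A y)) (\tr D).
Proof. by move=> dA; apply: is_derive_bigsum => k; exact: is_derive_entry. Qed.

Lemma is_derive_bigprod m (F : 'I_m -> V -> R) (D : 'I_m -> R) x v :
  (forall i, is_derive x v (F i) (D i)) ->
  is_derive x v (fun y => \prod_i F i y)
    (\sum_k \prod_i (if i == k then D i else F i x)).
Proof.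
elim: m F D => [|m IH] F D HF.
  rewrite big_ord0 (_ : (fun=> _) = cst 1); first exact: is_derive_cst.
  by apply/funext => y; rewrite big_ord0.
rewrite (_ : (fun=> _) = fun y => F ord0 y * \prod_i F (lift ord0 i) y); last first.
  by apply/funext => y; rewrite big_ord_recl.
have H2 := IH _ _ (fun i => HF (lift ord0 i)).
apply: is_derive_eq (is_deriveM_fun (HF ord0) H2) _.
rewrite big_ord_recl; congr (_ + _).
  by rewrite big_ord_recl eqxx.
rewrite mulr_sumr; apply: eq_bigr => k _.
rewrite big_ord_recl /=; congr (_ * _); apply: eq_bigr => i _.
Qed.

(** Jacobi's formula: by the product rule the derivative of the determinant is the
    sum over k of the determinants with row k replaced by its derivative, which
    are then expanded along that row. *)
Lemma is_derive_det p (A : V -> 'M[R]_p) D x v : is_derive x v A D ->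
  is_derive x v (fun y => \det (A y)) (\tr (\adj (A x) *m D)).
Proof.
move=> dA.
have H : is_derive x v (fun y => \det (A y))
    (\sum_(s : {perm 'I_p}) (-1) ^+ s *
       \sum_k \prod_i (if i == k then D i (s i) else A x i (s i))).
  apply: is_derive_bigsum => s.
  apply: is_derive_eq (is_deriveM_fun (is_derive_cst _ _ _) _) _.
    by apply: is_derive_bigprod => i; exact: is_derive_entry.
  by rewrite mul0r add0r.
apply: is_derive_eq H _.
under eq_bigr do rewrite mulr_sumr.
rewrite exchange_big /= mxtrace_mulC; apply: eq_bigr => k _.
pose B : 'M[R]_p := \matrix_(i, j) if i == k then D i j else A x i j.
transitivity (\det B).
  apply: eq_bigr => s _; congr (_ * _); apply: eq_bigr => i _.
  by rewrite mxE.
rewrite (expand_det_row B k) mxE; apply: eq_bigr => j _.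
rewrite !mxE eqxx; congr (_ * _); rewrite /cofactor; congr (_ * \det _).
by apply/matrixP => i l; rewrite !mxE eq_sym (negbTE (neq_lift _ _)).
Qed.

(** The derivative of A^k is a sum of k terms A^i D A^(k-1-i), all of which have the
    same trace after multiplication by a matrix that commutes with A. *)
Lemma is_derive_expmx p (A : V -> 'M[R]_p) D x v k : is_derive x v A D ->
  exists2 E, is_derive x v (fun y => A y ^+ k) E &
    forall Q, Q *m A x = A x *m Q ->
      \tr (Q *m E) = k%:R * \tr (Q *m A x ^+ k.-1 *m D).
Proof.
move=> dA; elim: k => [|k [E dE HE]].
  exists 0; last by move=> Q _; rewrite mulmx0 mxtrace0 mul0r.
  exact: is_derive_cst.
exists (D *m A x ^+ k + A x *m E).
  rewrite (_ : (fun=> _) = fun y => A y *m A y ^+ k); first exact: is_derive_mulmx.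
  by apply/funext => y; rewrite exprS mulmxE.
move=> Q QA.
have QAk m : Q *m A x ^+ m = A x ^+ m *m Q.
  elim: m => [|m IH]; first by rewrite expr0 mulmx1 mul1mx.
  by rewrite exprS -mulmxE mulmxA QA -mulmxA IH mulmxA.
have -> : \tr (Q *m (D *m A x ^+ k + A x *m E)) =
    \tr (Q *m A x ^+ k *m D) + \tr (Q *m A x *m E).
  by rewrite mulmxDr mxtraceD !mulmxA [X in X + _]mxtrace_mulC mulmxA -QAk.
rewrite HE; last by rewrite mulmxA -QA.
rewrite -[k.+1.-1]/k -(natr1 k) mulrDl mul1r addrC; congr (_ + _).
case: k {E dE HE} => [|k]; first by rewrite !mul0r.
by rewrite exprS -mulmxE !mulmxA.
Qed.

Lemma is_derive_invmx p (A : V -> 'M[R]_p) D x v : is_derive x v A D ->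
  (\forall y \near x, A y \in unitmx) -> derivable (fun y => invmx (A y)) x v ->
  is_derive x v (fun y => invmx (A y)) (- (invmx (A x) *m D *m invmx (A x))).
Proof.
move=> dA uA dI; have dI' := derivableP dI; set E := 'D_v _ _ in dI'.
have ux : A x \in unitmx by exact: nbhs_singleton uA.
have H1 := is_derive_mulmx dA dI'.
have H2 : is_derive x v (fun y => A y *m invmx (A y)) 0.
  apply: (near_eq_is_derive (f := cst 1%:M)).
  by apply: filterS uA => y uy; rewrite mulmxV.
have H3 : D *m invmx (A x) + A x *m E = 0 by case: H1 H2 => [_ <-] [_ <-].
apply: is_derive_eq dI' _.
rewrite -mulmxA -mulmxN -[D *m _]opprK (_ : - (D *m _) = A x *m E) ?opprK ?mulKmx//.
by apply/eqP; rewrite eq_sym -addr_eq0 addrC H3.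
Qed.

End MatrixDerivatives.

(** * Integer powers and the functions h_i *)

Section IntegerPowers.
Context {R : realType} {n : nat}.
Implicit Types A B : 'M[R]_n.

Definition mxpowz A (i : int) : 'M[R]_n :=
  match i with Posz m => A ^+ m | Negz m => invmx A ^+ m.+1 end.

Lemma mxpowz1 A : mxpowz A 1 = A.
Proof. exact: expr1. Qed.

Lemma mxpowzS A i : A \in unitmx -> mxpowz A (i + 1) = A *m mxpowz A i.
Proof.
move=> uA; case: i => [m|[|m]].
- by rewrite -PoszD addn1 /= exprS mulmxE.
- by rewrite /= expr1 mulmxV.
- rewrite (_ : Negz m.+1 + 1 = Negz m); last by rewrite !NegzE; lia.
  by rewrite /= [invmx A ^+ m.+2]exprS -mulmxE mulKVmx.
Qed.

Lemma mxpowzP A i : A \in unitmx -> mxpowz A (i - 1) = invmx A *m mxpowz A i.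
Proof. by move=> uA; rewrite -{2}[i](subrK 1) mxpowzS// mulKmx. Qed.

Lemma mxpowzD A i j : A \in unitmx -> mxpowz A (i + j) = mxpowz A i *m mxpowz A j.
Proof.
move=> uA; elim/int_rect: i => [|k IH|k IH].
- by rewrite add0r /= mul1mx.
- by rewrite -addn1 PoszD addrAC !mxpowzS// IH mulmxA.
- by rewrite -addn1 PoszD opprD addrAC !mxpowzP// IH mulmxA.
Qed.

Lemma mxpowz_comm A i : A \in unitmx -> mxpowz A i *m A = A *m mxpowz A i.
Proof. by move=> uA; rewrite -{2}(mxpowz1 A) -mxpowzD// mxpowzS. Qed.

Lemma mxpowz_conj A P Q i : P *m Q = 1%:M -> Q *m P = 1%:M -> A \in unitmx ->
  mxpowz (P *m A *m Q) i = P *m mxpowz A i *m Q.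
Proof.
move=> PQ QP uA.
have uP : P \in unitmx by case/mulmx1_unit: PQ.
have uQ : Q \in unitmx by case/mulmx1_unit: PQ.
have uB : P *m A *m Q \in unitmx by rewrite !unitmx_mul uP uA uQ.
elim/int_rect: i => [|k IH|k IH].
- by rewrite /= mulmx1.
- rewrite -addn1 PoszD !mxpowzS// IH !mulmxA; congr (_ *m _ *m _).
  by rewrite -!mulmxA QP mulmx1.
- rewrite -addn1 PoszD opprD !mxpowzP// IH.
  apply: (canLR (mulKmx uB)).
  rewrite -!mulmxA [Q *m _]mulmxA QP mul1mx; congr (_ *m _).
  by rewrite mulKVmx.
Qed.

(** If B intertwines A^T and A, it intertwines their integer powers. *)
Lemma mxpowz_tr A B i : A \in unitmx -> A *m B = B *m A^T ->
  B *m (mxpowz A i)^T = mxpowz A i *m B.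
Proof.
move=> uA AB.
have ABV : B *m (invmx A)^T = invmx A *m B.
  apply: (can_inj (mulKmx uA)); rewrite mulKVmx// mulmxA AB -mulmxA.
  by rewrite -trmx_mul mulVmx// trmx1 mulmx1.
elim/int_rect: i => [|k IH|k IH].
- by rewrite /= trmx1 mulmx1 mul1mx.
- rewrite -(addn1 k) PoszD mxpowzS// -{1}mxpowz_comm// trmx_mul mulmxA -AB.
  by rewrite -!mulmxA IH.
- rewrite -(addn1 k) PoszD opprD mxpowzP//.
  have cI : invmx A *m mxpowz A (- k%:Z) = mxpowz A (- k%:Z) *m invmx A.
    by rewrite -[invmx A]/(mxpowz A (-1)) -!mxpowzD// addrC.
  by rewrite {1}cI trmx_mul mulmxA ABV -!mulmxA IH.
Qed.

End IntegerPowers.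

Section CharacteristicFunctions.
Context {R : realType} {n : nat}.

(** The value of h_i at a point where the endomorphism has matrix A. *)
Definition power_trace (i : int) (A : 'M[R]_n) : R :=
  if i == 0 then - (2^-1 * ln `|\det A|)
  else - ((2 * i%:~R)^-1 * \tr (mxpowz A i)).

Lemma half_cancel (c t : R) : c != 0 -> (2 * c)^-1 * (c * t) = 2^-1 * t.
Proof. by move=> c0; field. Qed.

(** One formula for all integers i: the case i = 0 is the logarithmic derivative of
    the determinant, with \adj A / \det A = A^-1. *)
Lemma is_derive_power_trace (V : normedModType R) (A : V -> 'M[R]_n) D (x v : V) i :
  is_derive x v A D -> (\forall y \near x, A y \in unitmx) ->
  derivable (fun y => invmx (A y)) x v ->
  is_derive x v (fun y => power_trace i (A y))
    (- (2^-1 * \tr (mxpowz (A x) (i - 1) *m D))).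
Proof.
move=> dA uA dI.
have ux : A x \in unitmx by exact: nbhs_singleton uA.
have cmul (c : R) (f : V -> R) (d : R) : is_derive x v f d ->
    is_derive x v (fun y => - (c * f y)) (- (c * d)).
  move=> df; have H := is_deriveM_fun (is_derive_cst (- c) x v) df.
  rewrite (_ : (fun=> _) = fun y => cst (- c) y * f y); last first.
    by apply/funext => y; rewrite mulNr.
  by apply: is_derive_eq H _; rewrite mul0r add0r mulNr.
rewrite /power_trace; case: i => [[|k]|k].
- rewrite eqxx; apply: cmul.
  have d0 : \det (A x) != 0 by rewrite -unitfE -unitmxE.
  have H := is_derive_det dA.
  have H2 := is_derive_comp_scalar H (ln_norm_is_derive d0).
  apply: is_derive_eq H2 _.
  by rewrite /= expr1 /invmx ux -scalemxAl mxtraceZ.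
- have -> : Posz k.+1 - 1 = Posz k by lia.
  rewrite /=; have [E dE HE] := is_derive_expmx k.+1 dA.
  apply: is_derive_eq (cmul _ _ _ (is_derive_mxtrace dE)) _.
  have := HE 1%:M; rewrite !mul1mx mulmx1 => -> //.
  by rewrite -pmulrn half_cancel ?pnatr_eq0.
- have -> : Negz k - 1 = Negz k.+1 by rewrite !NegzE; lia.
  rewrite /=; have [E dE HE] := is_derive_expmx k.+1 (is_derive_invmx dA uA dI).
  apply: is_derive_eq (cmul _ _ _ (is_derive_mxtrace dE)) _.
  have := HE 1%:M; rewrite !mul1mx mulmx1 => -> //.
  rewrite NegzE; set I := invmx (A x).
  have -> : \tr (I ^+ k.+1.-1 *m - (I *m D *m I)) = - \tr (I ^+ k.+2 *m D).
    rewrite mulmxN raddfN /=; congr (- _).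
    rewrite !mulmxA [LHS]mxtrace_mulC !mulmxA.
    by rewrite [I ^+ k.+2]exprSr exprS -!mulmxE.
  set t := \tr _; rewrite mulrNz -pmulrn.
  rewrite (_ : k.+1%:R * - t = - k.+1%:R * t) ?half_cancel ?oppr_eq0 ?pnatr_eq0//.
  by rewrite mulrN mulNr.
Qed.

Lemma power_trace_conj i (A P Q : 'M[R]_n) : P *m Q = 1%:M -> Q *m P = 1%:M ->
  A \in unitmx -> power_trace i (P *m A *m Q) = power_trace i A.
Proof.
move=> PQ QP uA; rewrite /power_trace; case: ifP => _.
  rewrite !det_mulmx mulrAC -det_mulmx PQ det1 mul1r//.
by rewrite mxpowz_conj// mxtrace_mulC mulmxA QP mul1mx.
Qed.

Lemma smooth_power_trace m (U : set 'rV[R]_m) (A : 'rV[R]_m -> 'M[R]_n) i :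
  open U -> smooth_mat U A -> (forall x, U x -> A x \in unitmx) ->
  smooth_on U (fun x => power_trace i (A x)).
Proof.
move=> oU sA uA.
have scale (c : R) f : smooth_on U f -> smooth_on U (fun x => - (c * f x)).
  move=> sf; rewrite (_ : (fun=> _) = fun x => - c * f x).
    by apply: (smoothM oU _ sf); exact: smooth_cst.
  by apply/funext => x; rewrite mulNr.
rewrite /power_trace; case: (i == 0); apply: scale.
  apply: (smooth_ln_norm oU); first exact: smooth_det.
  by move=> x /uA; rewrite unitmxE unitfE.
apply: (smooth_mxtrace oU); case: i => k; apply: (smooth_expmx _ oU).
  exact: sA.
exact: (smooth_invmx oU sA uA).
Qed.

End CharacteristicFunctions.

(** * The two identities between first derivatives *)

Section CoordinateIdentities.
Context {R : realType} {n : nat}.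
Implicit Types (N S : 'M[R]_n) (P dS : 'I_n -> 'M[R]_n).

(** P a stands for the partial derivative d_a N; the hypothesis is the vanishing of
    the torsion on pairs of coordinate fields. Written with the matrix J of the
    partial derivatives of N e_a, it equates N P_a - sum_j N_ja P_j with the
    commutator N J - J N, whose product with Q has trace 0. *)
Lemma lenard_trace N P :
  (forall a b, N *m col b (P a) - N *m col a (P b) =
     \sum_j N j a *: col b (P j) - \sum_j N j b *: col a (P j)) ->
  forall Q a, Q *m N = N *m Q ->
    \sum_j N j a * \tr (Q *m P j) = \tr (Q *m N *m P a).
Proof.
move=> T Q a QN.
pose J := \matrix_(i, b) P b i a.
have E : N *m P a - N *m J = \sum_j N j a *: P j - J *m N.
  apply/matrixP => i b; have := T a b; move/matrixP/(_ i 0).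
  rewrite !mxE !summxE => TE.
  transitivity (\sum_j N i j * P a j b - \sum_j N i j * P b j a).
    by congr (_ - _); apply: eq_bigr => j _; rewrite ?mxE.
  have -> : \sum_j N i j * P a j b = \sum_j N i j * col b (P a) j 0.
    by apply: eq_bigr => j _; rewrite mxE.
  have -> : \sum_j N i j * P b j a = \sum_j N i j * col a (P b) j 0.
    by apply: eq_bigr => j _; rewrite mxE.
  rewrite TE; congr (_ - _); apply: eq_bigr => j _; rewrite !mxE//.
  by rewrite mulrC.
transitivity (\tr (Q *m (\sum_j N j a *: P j))).
  rewrite mulmx_sumr raddf_sum; apply: eq_bigr => j _.
  by rewrite /= -scalemxAr mxtraceZ.
have -> : \sum_j N j a *: P j = N *m P a - N *m J + J *m N by rewrite E subrK.
rewrite mulmxDr mulmxBr mxtraceD raddfB /= !mulmxA [\tr (Q *m J *m N)]mxtrace_mulC.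
by rewrite mulmxA -QN subrK.
Qed.

(** P c and dS c stand for the partial derivatives of N and S, and the last
    hypothesis is the compatibility of the brackets of 1-forms on dx_a and dx_b,
    at index c. Both it and the derivative of N S = S N^T are contracted over
    b = c; the terms that contain dS cancel between the two. *)
Lemma koszul_trace N S P dS :
  S^T = - S -> (forall c, (dS c)^T = - dS c) ->
  (forall c, P c *m S + N *m dS c = dS c *m N^T + S *m (P c)^T) ->
  (forall a b c, (P c *m S + N *m dS c) b a =
     - (\sum_j S j b * P j a c) - \sum_j N a j * dS c j b
     + \sum_j S j a * P j b c + \sum_j N b j * dS c j a
     - \sum_j dS j b a * N j c) ->
  forall a, \sum_i \sum_j S j i * P j a i = - (2^-1 * \sum_j S a j * \tr (P j)).
Proof.
move=> aS adS rel K a.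
have aSE i j : S i j = - S j i by have /matrixP/(_ j i) := aS; rewrite !mxE.
have adSE c i j : dS c i j = - dS c j i by have /matrixP/(_ j i) := adS c; rewrite !mxE.
(* the five distinct contractions that remain once the skewness of S and dS is used *)
pose X1 := \sum_b \sum_j P b b j * S j a.
pose X2 := \sum_b \sum_j N b j * dS b j a.
pose X3 := \sum_b \sum_j S j b * P j a b.
pose X4 := \sum_b \sum_j N a j * dS b j b.
pose X5 := \sum_j S j a * \tr (P j).
have e1 : X1 + X2 = - X3 - X4 + X5 + X2 - X2.
  have -> : X1 + X2 = \sum_b (P b *m S + N *m dS b) b a.
    by rewrite -big_split; apply: eq_bigr => b _; rewrite !mxE.
  under eq_bigr do rewrite K.
  rewrite !big_split /= !sumrN.
  congr (- _ - _ + _ + _ - _).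
    rewrite exchange_big; apply: eq_bigr => j _ /=.
    by rewrite -mulr_sumr.
  rewrite exchange_big; apply: eq_bigr => j _ /=; apply: eq_bigr => b _.
  by rewrite mulrC.
have e2 : - X3 + X4 = - X2 - X1.
  have -> : - X3 + X4 = \sum_b (P b *m S + N *m dS b) a b.
    transitivity (\sum_b (\sum_j P b a j * S j b + \sum_j N a j * dS b j b)).
      rewrite big_split /=; congr (_ + _).
      rewrite exchange_big /= -sumrN; apply: eq_bigr => j _ /=.
      by rewrite -sumrN; apply: eq_bigr => b _; rewrite aSE; ring.
    by apply: eq_bigr => b _; rewrite !mxE.
  under eq_bigr do rewrite rel.
  transitivity (\sum_b (\sum_j dS b a j * N b j + \sum_j S a j * P b b j)).
    by apply: eq_bigr => b _; rewrite !mxE; congr (_ + _); apply: eq_bigr => j _; rewrite mxE.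
  rewrite big_split /= -!sumrN; congr (_ + _); apply: eq_bigr => b _.
    by rewrite -sumrN; apply: eq_bigr => j _; rewrite adSE; ring.
  by rewrite -sumrN; apply: eq_bigr => j _; rewrite aSE; ring.
have -> : \sum_j S a j * \tr (P j) = - X5.
  by rewrite -sumrN; apply: eq_bigr => j _; rewrite aSE mulNr.
rewrite -/X3; lra.
Qed.

End CoordinateIdentities.

(** * Alternating forms of maximal degree *)

Section VolumeForms.
Context {R : realType} {n : nat}.
Variable mu : ('I_n -> 'cV[R]_n) -> R.
Hypothesis mu_lin : forall k (v : 'I_n -> 'cV[R]_n) (a : R) (x y : 'cV[R]_n),
  mu (fun l => if l == k then a *: x + y else v l) =
  a * mu (fun l => if l == k then x else v l)
  + mu (fun l => if l == k then y else v l).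
Hypothesis mu_alt : forall (v : 'I_n -> 'cV[R]_n) k l, k != l -> v k = v l -> mu v = 0.

Lemma alternating0 v k : mu (fun l => if l == k then 0 else v l) = 0.
Proof.
have := mu_lin k v 1 0 0; rewrite scaler0 addr0 mul1r => /eqP.
by rewrite -subr_eq0 opprD addrA subrr sub0r oppr_eq0 => /eqP.
Qed.

Lemma alternating_sum v k I (r : seq I) (a : I -> R) (w : I -> 'cV[R]_n) :
  mu (fun l => if l == k then \sum_(i <- r) a i *: w i else v l) =
  \sum_(i <- r) a i * mu (fun l => if l == k then w i else v l).
Proof.
elim: r => [|i r IH].
  rewrite [RHS]big_nil -(alternating0 v k); congr mu.
  by apply/funext => l; rewrite big_nil.
rewrite [RHS]big_cons -IH -mu_lin; congr mu.
by apply/funext => l; rewrite big_cons.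
Qed.

Lemma alternating_replace v k i :
  mu (fun l => if l == k then v i else v l) = (i == k)%:R * mu v.
Proof.
case: (altP (i =P k)) => [->|ik].
  by rewrite mul1r; congr mu; apply/funext => l; case: eqP => [->|].
rewrite mul0r; apply: (@mu_alt _ i k) => //.
by rewrite eqxx (negbTE ik).
Qed.

Definition frame_mx (v : 'I_n -> 'cV[R]_n) : 'M[R]_n := \matrix_(i, j) v j i 0.

Lemma frame_mxE v (w : 'cV[R]_n) : frame_mx v *m w = \sum_j w j 0 *: v j.
Proof.
apply/colP => i; rewrite summxE mxE; apply: eq_bigr => j _.
by rewrite !mxE mulrC.
Qed.

(** On a linearly dependent family, one vector is a combination of the others and
    the form vanishes. *)
Lemma alternating_frame_unit v : mu v != 0 -> frame_mx v \in unitmx.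
Proof.
apply: contraR => nu.
have nu' : (frame_mx v)^T \notin unitmx by rewrite unitmx_tr.
have [w w0 wv] : exists2 w : 'rV[R]_n, w != 0 & w *m (frame_mx v)^T = 0.
  have := nu'; rewrite -row_free_unit -kermx_eq0 => /rowV0Pn[w wk w0].
  by exists w => //; apply/sub_kermxP.
have {}wv : \sum_j w 0 j *: v j = 0.
  have := congr1 trmx wv; rewrite trmx_mul trmxK trmx0 frame_mxE => wE; rewrite -[RHS]wE.
  by apply: eq_bigr => j _; rewrite mxE.
have [k wk] : exists k, w 0 k != 0.
  by have /rV0Pn := w0.
have := alternating_sum v k (index_enum _) (fun j => w 0 j) v.
rewrite wv alternating0 (bigD1 k)//= alternating_replace eqxx mul1r big1.
  by rewrite addr0 => /esym/eqP; rewrite mulf_eq0 (negbTE wk).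
by move=> j jk; rewrite alternating_replace (negbTE jk) mul0r mulr0.
Qed.

(** In the basis v, only the diagonal coefficient of A v_k survives in the k-th
    term, the others producing a repeated vector. *)
Lemma alternating_trace v (A : 'M[R]_n) : mu v != 0 ->
  \sum_k mu (fun l => if l == k then A *m v k else v l) = \tr A * mu v.
Proof.
move=> v0.
have uV := alternating_frame_unit v0.
pose B := invmx (frame_mx v) *m A *m frame_mx v.
have -> : \tr A = \tr B by rewrite /B mxtrace_mulC mulmxA mulmxV// mul1mx.
rewrite /mxtrace mulr_suml; apply: eq_bigr => k _.
have -> : A *m v k = \sum_j B j k *: v j.
  transitivity (frame_mx v *m col k B).
    rewrite /B -mulmxA colE -!mulmxA mulKVmx//; congr (_ *m _).
    by apply/colP => i; rewrite -colE !mxE.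
  by rewrite frame_mxE; apply: eq_bigr => j _; rewrite mxE.
rewrite alternating_sum (bigD1 k)//= alternating_replace eqxx mul1r big1 ?addr0//.
by move=> j jk; rewrite alternating_replace (negbTE jk) mul0r mulr0.
Qed.

End VolumeForms.

(** * Charts and extension of local objects *)

Section Charts.
Context {R : realType} {n : nat} {M : smoothManifold R n}.
Implicit Types (p q : M) (c d e : chart R n M) (f g : M -> R).

Lemma chart_at_atlas p : atlas (chart_at p).
Proof. by rewrite /chart_at; case: cid => c []. Qed.

Lemma chart_at_dom p : cdom (chart_at p) p.
Proof. by rewrite /chart_at; case: cid => c []. Qed.

Lemma cmap_inv c p : cdom c p -> cinv c (c p) = p.
Proof. by move=> cp; apply: cmapK; rewrite inE. Qed.

Lemma cinv_dom c x : (c @` cdom c) x -> cdom c (cinv c x) /\ c (cinv c x) = x.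
Proof. by move=> [p cp <-]; rewrite cmap_inv. Qed.

Lemma near_cdom c p : cdom c p -> \forall q \near p, cdom c q.
Proof. by move=> cp; apply: open_nbhs_nbhs; split => //; exact: open_cdom. Qed.

Lemma near_cinv c p (P : M -> Prop) : cdom c p -> (\forall q \near p, P q) ->
  \forall x \near c p, (c @` cdom c) x /\ P (cinv c x).
Proof.
move=> cp Pp.
have Ux : (c @` cdom c) (c p) by exists p.
apply: filterI; first by apply: open_nbhs_nbhs; split => //; exact: open_cimage.
have := @cinv_continuous _ _ _ c _ Ux; apply.
by rewrite cmap_inv.
Qed.

Lemma near_cmap c p (P : 'rV[R]_n -> Prop) : cdom c p -> (\forall x \near c p, P x) ->
  \forall q \near p, P (c q).
Proof. by move=> cp Pp; have := @cmap_continuous _ _ _ c _ cp; apply. Qed.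

Lemma open_chart_image c (W : set M) : open W -> open (c @` (cdom c `&` W)).
Proof.
move=> oW; rewrite openE => _ [p [cp Wp] <-].
have : \forall q \near p, W q by exact: open_nbhs_nbhs.
move=> /(near_cinv cp); apply: filterS => x [Ux Wx].
by have [cx <-] := cinv_dom Ux; exists (cinv c x).
Qed.

Lemma open_overlap c d : open (d @` (cdom c `&` cdom d)).
Proof. by rewrite setIC; apply: open_chart_image; exact: open_cdom. Qed.

Lemma overlap_inv c d x : (d @` (cdom c `&` cdom d)) x ->
  [/\ cdom c (cinv d x), cdom d (cinv d x), d (cinv d x) = x &
      (c @` (cdom d `&` cdom c)) (c (cinv d x))].
Proof.
move=> [p [cp dp] <-]; rewrite cmap_inv//; split => //.
by exists p.
Qed.

Lemma pd_near_eq c i f g p : cdom c p -> {near p, f =1 g} -> pd c i f p = pd c i g p.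
Proof.
move=> cp fg; apply: partial_near_eq.
by apply: filterS (near_cinv cp fg) => x [].
Qed.

(** f is only required to be smooth near c p, so that it may be a coordinate of
    another chart. *)
Lemma pd_change c d (V : set 'rV[R]_n) f p j : atlas c -> atlas d ->
  cdom c p -> cdom d p -> open V -> V (c p) -> smooth_on V (f \o cinv c) ->
  pd d j f p = \sum_i pd c i f p * jac c d p i j.
Proof.
move=> ac ad cp dp oV Vp sf.
have dI : forall i, derivable (fun x => c (cinv d x) 0 i) (d p) (delta_mx 0 j).
  move=> i; apply: smooth_derivable (atlas_compatible ac ad i) _.
  by exists p.
have H := @comp_row_is_derive R n n V (f \o cinv c) (fun x => c (cinv d x)) (d p)
  (delta_mx 0 j) oV sf.
rewrite /= cmap_inv// in H.
have [_] := H Vp dI.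
rewrite /pd /partial => HE.
transitivity ('D_(delta_mx 0 j) ((f \o cinv c) \o (fun x => c (cinv d x))) (d p)).
  apply: near_eq_derive.
  have := near_cinv dp (near_cdom cp); apply: filterS => x [_ cx] /=.
  by rewrite cmap_inv.
by rewrite HE; apply: eq_bigr => i _; rewrite mxE.
Qed.

Lemma jac_comp c d e p : atlas c -> atlas d -> atlas e ->
  cdom c p -> cdom d p -> cdom e p -> jac c e p = jac c d p *m jac d e p.
Proof.
move=> ac ad ae cp dp ep; apply/matrixP => i j; rewrite !mxE.
rewrite (@pd_change d e (d @` (cdom c `&` cdom d)) _ p j ad ae dp ep).
- by apply: eq_bigr => k _; rewrite !mxE.
- exact: open_overlap.
- by exists p.
- exact: atlas_compatible.
Qed.

Lemma jac_id c p : cdom c p -> jac c c p = 1%:M.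
Proof.
move=> cp; apply/matrixP => i j; rewrite !mxE /pd /partial.
transitivity ('D_(delta_mx 0 j) (fun x : 'rV[R]_n => x 0 i) (c p)).
  apply: near_eq_derive; have := near_cinv cp (near_cdom cp).
  by apply: filterS => x [Ux _] /=; have [_ ->] := cinv_dom Ux.
have := derive_id (c p) (delta_mx (0 : 'I_1) j : 'rV[R]_n).
rewrite derive_mx; last exact: derivable_id.
by move=> /matrixP/(_ 0 i); rewrite !mxE eqxx eq_sym /= eq_sym.
Qed.

Lemma jacK c d p : atlas c -> atlas d -> cdom c p -> cdom d p ->
  jac c d p *m jac d c p = 1%:M.
Proof. by move=> ac ad cp dp; rewrite -jac_comp// jac_id. Qed.

Lemma smooth_jac c d i j : atlas c -> atlas d ->
  smooth_on (d @` (cdom c `&` cdom d)) (fun x => jac c d (cinv d x) i j).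
Proof.
move=> ac ad.
apply: (@smooth_eq _ _ _ (partial j (fun x => c (cinv d x) 0 i)) _ (@open_overlap c d)).
  by move=> x /overlap_inv [_ _ dx _]; rewrite mxE /pd dx.
apply: smooth_partial; exact: atlas_compatible.
Qed.

Lemma smooth_pullback c d (f : 'rV[R]_n -> R) : atlas c -> atlas d ->
  smooth_on (c @` (cdom d `&` cdom c)) f ->
  smooth_on (d @` (cdom c `&` cdom d)) (fun x => f (c (cinv d x))).
Proof.
move=> ac ad sf; apply: (smooth_comp (@open_overlap c d) (@open_overlap d c) sf).
  by move=> x /overlap_inv[].
by move=> j; exact: atlas_compatible.
Qed.

Lemma smooth_jac_rev c d i j : atlas c -> atlas d ->
  smooth_on (d @` (cdom c `&` cdom d)) (fun x => jac d c (cinv d x) i j).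
Proof.
move=> ac ad.
pose g y := d (cinv c y) 0 i.
apply: (@smooth_eq _ _ _ (fun x => partial j g (c (cinv d x))) _ (@open_overlap c d)).
  by move=> x _; rewrite mxE.
apply: (smooth_pullback ac ad); apply: smooth_partial; exact: atlas_compatible.
Qed.

(** The support is the image of a compact ball, hence compact, hence closed because
    the manifold is Hausdorff. This is what allows extension by 0. *)
Lemma bump_at c p : cdom c p ->
  exists psi (K : set M), [/\ closed K, K `<=` cdom c,
    forall q, ~ K q -> psi q = 0, \forall q \near p, psi q = 1 &
    smooth_on (c @` cdom c) (psi \o cinv c)].
Proof.
move=> cp.
have : \forall x \near c p, (c @` cdom c) x.
  by apply: open_nbhs_nbhs; split; [exact: open_cimage|exists p].
move=> /nbhs_ballP[r /= r0 rU].
have r20 : 0 < r / 2 by rewrite divr_gt0.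
have [phi [sphi phi1 phi0]] := bump_exists (c p) r20.
pose psi q := if `[< cdom c q >] then phi (c q) else 0.
pose B := [set x | `|x - c p| <= r / 2].
have BU : B `<=` c @` cdom c.
  move=> x Bx; apply: rU; rewrite -ball_normE/= -normrN opprB.
  by apply: le_lt_trans Bx _; rewrite ltr_pdivrMr// ltr_pMr// ltr1n.
have cB : compact B.
  apply: bounded_closed_compact.
    exists (r / 2 + `|c p|); split; first exact: num_real.
    move=> y ry x Bx; apply: le_trans (ltW ry).
    by rewrite -[x](subrK (c p)) (le_trans (ler_normD _ _))// lerD2r.
  have -> : B = closed_ball (c p) (r / 2).
    rewrite closed_ballE//; apply/seteqP; split => x; rewrite /B /closed_ball_ /=.
      by rewrite -normrN opprB.
    by rewrite -normrN opprB.
  exact: closed_ball_closed.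
exists psi, (cinv c @` B); split.
- apply: compact_closed; first exact: manifold_hausdorff.
  apply: continuous_compact cB.
  apply: continuous_in_subspaceT => x; rewrite inE => /BU Ux.
  exact: cinv_continuous.
- by move=> _ [x /BU Ux <-]; have [] := cinv_dom Ux.
- move=> q nq; rewrite /psi; case: asboolP => // cq; apply: phi0.
  rewrite leNgt; apply/negP => h; apply: nq; exists (c q); last exact: cmap_inv.
  exact: ltW.
- have h1 := near_cmap cp phi1; have h2 := near_cdom cp.
  near=> q.
  have cq : cdom c q by near: q.
  have p1 : phi (c q) = 1 by near: q.
  by rewrite /psi (asboolT cq).
- apply: (@smooth_eq _ _ _ phi _ (@open_cimage R n M c)).
    by move=> x Ux; have [cx xE] := cinv_dom Ux; rewrite /psi /= (asboolT cx) xE.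
  exact: smooth_subset sphi.
Unshelve. all: by end_near. Qed.

(** Away from the domain of c, and hence of K, g vanishes on the open complement of
    K. *)
Lemma smooth_extend c d (K : set M) g : atlas c -> atlas d -> closed K ->
  K `<=` cdom c -> (forall q, ~ K q -> g q = 0) ->
  smooth_on (d @` (cdom c `&` cdom d)) (g \o cinv d) ->
  smooth_on (d @` cdom d) (g \o cinv d).
Proof.
move=> ac ad cK Kc g0 sg; apply: smooth_local => _ [q dq <-].
have [cq|ncq] := pselect (cdom c q).
  exists (d @` (cdom c `&` cdom d)); split => //; by exists q.
exists (d @` (cdom d `&` ~` K)); split; first by exists q => //; split => // /Kc.
have oV : open (d @` (cdom d `&` ~` K)).
  by apply: open_chart_image; exact: closed_openC.
apply: (@smooth_eq _ _ _ (fun=> 0) _ oV); last exact: smooth_cst.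
by move=> _ [p [dp nKp] <-] /=; rewrite cmap_inv// g0.
Qed.

Lemma smooth_cutoff c d (K : set M) psi g (h : 'rV[R]_n -> R) :
  atlas c -> atlas d -> closed K -> K `<=` cdom c ->
  smooth_on (c @` cdom c) (psi \o cinv c) -> (forall q, ~ K q -> g q = 0) ->
  smooth_on (d @` (cdom c `&` cdom d)) h ->
  (forall q, cdom c q -> cdom d q -> g q = psi q * h (d q)) ->
  smooth_on (d @` cdom d) (g \o cinv d).
Proof.
move=> ac ad cK Kc spsi g0 sh gE; apply: (smooth_extend ac ad cK Kc g0).
have oV : open (d @` (cdom c `&` cdom d)) by exact: open_overlap.
apply: (@smooth_eq _ _ _ (fun x => (psi \o cinv c) (c (cinv d x)) * h x) _ oV).
  by move=> x /overlap_inv [cx dx xE _]; rewrite /= cmap_inv// gE// xE.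
apply: (smoothM oV _ sh); apply: (smooth_pullback ac ad).
by apply: smooth_subset spsi => _ [q [_ cq] <-]; exists q.
Qed.

End Charts.

(** * Components of tensors in a chart *)

Section Components.
Context {R : realType} {n : nat} {M : smoothManifold R n}.
Implicit Types (p q : M) (c d : chart R n M) (f g : M -> R).
Implicit Types (X Y : vfield M) (a b : oneform M) (N : endfield M) (S : bivfield M).

Section AtPoint.
Variables (c : chart R n M) (q : M).
Hypotheses (ac : atlas c) (cq : cdom c q).

Lemma jac_chart_at : jac c (chart_at q) q *m jac (chart_at q) c q = 1%:M.
Proof. apply: jacK => //; [exact: chart_at_atlas|exact: chart_at_dom]. Qed.

Lemma chart_at_jac : jac (chart_at q) c q *m jac c (chart_at q) q = 1%:M.
Proof. apply: jacK => //; [exact: chart_at_atlas|exact: chart_at_dom]. Qed.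

Lemma end_vfield_in N X :
  vfield_in c (end_vfield N X) q = endfield_in c N q *m vfield_in c X q.
Proof.
rewrite /vfield_in /endfield_in /end_vfield.
by rewrite -!mulmxA [jac (chart_at q) c q *m _]mulmxA chart_at_jac mul1mx.
Qed.

Lemma end_oneform_in N a :
  oneform_in c (end_oneform N a) q = oneform_in c a q *m endfield_in c N q.
Proof.
rewrite /oneform_in /endfield_in /end_oneform !mulmxA.
by rewrite -[_ *m jac _ c q *m jac c _ q]mulmxA chart_at_jac mulmx1.
Qed.

Lemma sharp_in S a :
  vfield_in c (sharp S a) q = bivfield_in c S q *m (oneform_in c a q)^T.
Proof.
rewrite /vfield_in /bivfield_in /oneform_in /sharp trmx_mul !mulmxA.
by rewrite -[_ *m (jac c _ _)^T *m _]mulmxA -trmx_mul chart_at_jac trmx1 mulmx1.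
Qed.

Lemma end_bivfield_in N S :
  bivfield_in c (end_bivfield N S) q = endfield_in c N q *m bivfield_in c S q.
Proof.
rewrite /bivfield_in /endfield_in /end_bivfield !mulmxA.
by rewrite -[_ *m jac _ c q *m jac c _ q]mulmxA chart_at_jac mulmx1.
Qed.

Lemma pairing_in a X : pairing a X q = (oneform_in c a q *m vfield_in c X q) 0 0.
Proof.
rewrite /pairing /vfield_in /oneform_in mulmxA.
by rewrite -[_ *m jac _ c q *m jac c _ q]mulmxA chart_at_jac mulmx1.
Qed.

Lemma diffl_in f : smooth f -> oneform_in c (diffl f) q = \row_i pd c i f q.
Proof.
move=> sf; apply/rowP => j; rewrite !mxE.
rewrite (@pd_change _ _ _ (chart_at q) c (chart_at q @` cdom (chart_at q)) f q j).
- by apply: eq_bigr => i _; rewrite mxE.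
- exact: chart_at_atlas.
- exact: ac.
- exact: chart_at_dom.
- exact: cq.
- exact: open_cimage.
- by exists q => //; exact: chart_at_dom.
- exact: sf (chart_at_atlas q).
Qed.

Lemma endfield_in_unit N : N q \in unitmx -> endfield_in c N q \in unitmx.
Proof.
move=> uN; rewrite /endfield_in !unitmx_mul uN.
by have [-> ->] := mulmx1_unit jac_chart_at.
Qed.

(** Traces and determinants do not depend on the basis. *)
Lemma h_in N i : N q \in unitmx -> h_ N i q = power_trace i (endfield_in c N q).
Proof.
by move=> uN; rewrite power_trace_conj//; [exact: jac_chart_at|exact: chart_at_jac].
Qed.

End AtPoint.

Lemma jac_at p : jac (chart_at p) (chart_at p) p = 1%:M.
Proof. by rewrite jac_id//; exact: chart_at_dom. Qed.

Lemma vfield_at X p : vfield_in (chart_at p) X p = X p.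
Proof. by rewrite /vfield_in jac_at mul1mx. Qed.
Lemma oneform_at a p : oneform_in (chart_at p) a p = a p.
Proof. by rewrite /oneform_in jac_at mulmx1. Qed.
Lemma endfield_at N p : endfield_in (chart_at p) N p = N p.
Proof. by rewrite /endfield_in jac_at mul1mx mulmx1. Qed.
Lemma bivfield_at S p : bivfield_in (chart_at p) S p = S p.
Proof. by rewrite /bivfield_in jac_at mul1mx trmx1 mulmx1. Qed.

Lemma smooth_h N i : smooth_endfield N -> (forall p, N p \in unitmx) -> smooth (h_ N i).
Proof.
move=> sN uN c ac; have oU := @open_cimage R n M c.
apply: (@smooth_eq _ _ _ (fun x => power_trace i (endfield_in c N (cinv c x))) _ oU).
  by move=> x Ux; have [cx _] := cinv_dom Ux; rewrite /= (h_in ac cx).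
apply: (smooth_power_trace _ oU); first exact: sN.
by move=> x Ux; have [cx _] := cinv_dom Ux; exact: endfield_in_unit.
Qed.

Lemma smooth_hamvf S f : smooth_bivfield S -> smooth f -> smooth_vfield (hamvf S f).
Proof.
move=> sS sf c ac; have oU := @open_cimage R n M c.
pose G x := bivfield_in c S (cinv c x) *m (\row_i partial i (f \o cinv c) x)^T.
have sG : smooth_mat (c @` cdom c) G.
  apply: (smooth_mulmx oU (sS c ac)); apply: smooth_trmx => i j.
  rewrite (_ : (fun=> _) = partial j (f \o cinv c)); last first.
    by apply/funext => x; rewrite mxE.
  exact: smooth_partial (sf c ac).
move=> i j; apply: (smooth_eq oU _ (sG i j)) => x Ux; have [cx xE] := cinv_dom Ux.
rewrite /hamvf sharp_in// diffl_in// /G; congr ((_ *m _^T) i j).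
by apply/rowP => k; rewrite !mxE /pd xE.
Qed.

End Components.

(** * Global extensions of coordinate objects *)

Section Extensions.
Context {R : realType} {n : nat} {M : smoothManifold R n}.
Implicit Types (p q : M) (X : vfield M).

(** The torsion hypothesis speaks of global smooth fields; this provides fields with
    constant components near p to test it on. *)
Lemma extend_vfield p (v : 'cV[R]_n) : exists X, smooth_vfield X /\
  \forall q \near p, vfield_in (chart_at p) X q = v.
Proof.
pose c := chart_at p; have ac : atlas c := chart_at_atlas p.
have cp : cdom c p := chart_at_dom p.
have [psi [K [cK Kc psi0 psi1 spsi]]] := bump_at cp.
pose X : vfield M := fun q => psi q *: (jac (chart_at q) c q *m v).
have XE d q : atlas d -> cdom c q -> cdom d q ->
    vfield_in d X q = psi q *: (jac d c q *m v).
  move=> ad cq dq; rewrite /vfield_in /X -scalemxAr mulmxA -jac_comp//.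
    exact: chart_at_atlas.
  exact: chart_at_dom.
exists X; split; last first.
  near=> q.
  have cq : cdom c q by near: q; exact: near_cdom.
  rewrite XE// jac_id// mul1mx (_ : psi q = 1) ?scale1r//.
  by near: q.
move=> d ad i j.
apply: (smooth_cutoff (g := fun q => vfield_in d X q i j)
  (h := fun x => \sum_k jac d c (cinv d x) i k * v k j) ac ad cK Kc spsi).
- by move=> q /psi0 q0; rewrite /vfield_in /X q0 scale0r mulmx0 mxE.
- have oV := @open_overlap _ _ _ c d.
  apply: (smooth_sum _ oV) => k; apply: (smoothM oV); last exact: smooth_cst.
  exact: smooth_jac_rev.
- by move=> q cq dq; rewrite XE// !mxE cmap_inv.
Unshelve. all: by end_near. Qed.

Lemma extend_oneform p (w : 'rV[R]_n) : exists a : oneform M, smooth_oneform a /\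
  \forall q \near p, oneform_in (chart_at p) a q = w.
Proof.
pose c := chart_at p; have ac : atlas c := chart_at_atlas p.
have cp : cdom c p := chart_at_dom p.
have [psi [K [cK Kc psi0 psi1 spsi]]] := bump_at cp.
pose a : oneform M := fun q => psi q *: (w *m jac c (chart_at q) q).
have aE d q : atlas d -> cdom c q -> cdom d q ->
    oneform_in d a q = psi q *: (w *m jac c d q).
  move=> ad cq dq; rewrite /oneform_in /a -scalemxAl -mulmxA -jac_comp//.
    exact: chart_at_atlas.
  exact: chart_at_dom.
exists a; split; last first.
  near=> q.
  have cq : cdom c q by near: q; exact: near_cdom.
  rewrite aE// jac_id// mulmx1 (_ : psi q = 1) ?scale1r//.
  by near: q.
move=> d ad i j.
apply: (smooth_cutoff (g := fun q => oneform_in d a q i j)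
  (h := fun x => \sum_k w i k * jac c d (cinv d x) k j) ac ad cK Kc spsi).
- by move=> q /psi0 q0; rewrite /oneform_in /a q0 scale0r mul0mx mxE.
- have oV := @open_overlap _ _ _ c d.
  apply: (smooth_sum _ oV) => k; apply: (smoothM oV); first exact: smooth_cst.
  exact: smooth_jac.
- by move=> q cq dq; rewrite aE// !mxE cmap_inv.
Unshelve. all: by end_near. Qed.

Lemma extend_coord p (k : 'I_n) : exists f : M -> R, smooth f /\
  \forall q \near p, f q = chart_at p q 0 k.
Proof.
pose c := chart_at p; have ac : atlas c := chart_at_atlas p.
have cp : cdom c p := chart_at_dom p.
have [psi [K [cK Kc psi0 psi1 spsi]]] := bump_at cp.
exists (fun q => psi q * c q 0 k); split; last first.
  by near=> q; rewrite (_ : psi q = 1) ?mul1r//; near: q.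
move=> d ad.
apply: (smooth_cutoff (h := fun x => c (cinv d x) 0 k) ac ad cK Kc spsi).
- by move=> q /psi0 q0; rewrite q0 mul0r.
- exact: atlas_compatible.
- by move=> q cq dq; rewrite cmap_inv.
Unshelve. all: by end_near. Qed.

End Extensions.

(** * First derivatives at a point *)

Section LocalDerivatives.
Context {R : realType} {n : nat} {M : smoothManifold R n}.
Variable p : M.
Let c := chart_at p.
Let ac : atlas c := chart_at_atlas p.
Let cp : cdom c p := chart_at_dom p.
Implicit Types (q : M) (X Y : vfield M) (a b : oneform M) (N : endfield M) (S : bivfield M).

(** D is the derivative at p of the matrix-valued F along the j-th coordinate of the
    chart at p. A relation, rather than a function, it carries the derivability of
    F. *)
Definition pder (j : 'I_n) r s (F : M -> 'M[R]_(r, s)) (D : 'M[R]_(r, s)) : Prop :=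
  is_derive (chart_at p p) (delta_mx 0 j : 'rV[R]_n)
    (fun x => F (cinv (chart_at p) x)) D.

Lemma pder_near j r s (F G : M -> 'M[R]_(r, s)) D :
  (\forall q \near p, F q = G q) -> pder j F D -> pder j G D.
Proof.
move=> FG; apply: near_eq_is_derive.
by apply: filterS (near_cinv cp FG) => x [].
Qed.

Lemma pder_cst j r s (A : 'M[R]_(r, s)) : pder j (fun=> A) 0.
Proof. exact: is_derive_cst. Qed.

Lemma pder_mulmx j r s t (F : M -> 'M[R]_(r, s)) (G : M -> 'M[R]_(s, t)) D E :
  pder j F D -> pder j G E ->
  pder j (fun q => F q *m G q) (D *m G p + F p *m E).
Proof.
by move=> dF dG; have := is_derive_mulmx dF dG; rewrite cmap_inv.
Qed.

Lemma pder_trmx j r s (F : M -> 'M[R]_(r, s)) D :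
  pder j F D -> pder j (fun q => (F q)^T) D^T.
Proof. exact: is_derive_trmx. Qed.

Lemma pder_pd j r s (F : M -> 'M[R]_(r, s)) D i k :
  pder j F D -> pd c j (fun q => F q i k) p = D i k.
Proof. by move=> dF; have [_ <-] := is_derive_entry i k dF. Qed.

Lemma pder_smooth j r s (F : M -> 'M[R]_(r, s)) :
  smooth_mat (c @` cdom c) (fun x => F (cinv c x)) ->
  pder j F (\matrix_(i, k) pd c j (fun q => F q i k) p).
Proof.
move=> sF; apply: is_derive_mx => i k; rewrite mxE; apply: derivableP.
by apply: smooth_derivable (sF i k) _; exists p.
Qed.

Lemma actE X (f : M -> R) : act X f p = \sum_j X p j 0 * pd c j f p.
Proof.
by rewrite /act /pairing mxE; apply: eq_bigr => j _; rewrite !mxE mulrC.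
Qed.

Lemma lie_bracketE X Y DX DY :
  (forall j, pder j (vfield_in c X) (DX j)) ->
  (forall j, pder j (vfield_in c Y) (DY j)) ->
  lie_bracket X Y p = \sum_j X p j 0 *: DY j - \sum_j Y p j 0 *: DX j.
Proof.
move=> dX dY; apply/colP => i; rewrite !mxE !summxE actE; congr (_ - _).
  by apply: eq_bigr => j _; rewrite (pder_pd _ _ (dY j)) mxE.
by apply: eq_bigr => j _; rewrite !mxE (pder_pd _ _ (dX j)) mulrC.
Qed.

Lemma lie_oneformE X a DX Da :
  (forall j, pder j (vfield_in c X) (DX j)) ->
  (forall j, pder j (oneform_in c a) (Da j)) ->
  lie_oneform X a p = \sum_j X p j 0 *: Da j + \row_i (a p *m DX i) 0 0.
Proof.
move=> dX da; apply/rowP => i; rewrite !mxE !summxE actE; congr (_ + _).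
  by apply: eq_bigr => j _; rewrite (pder_pd _ _ (da j)) mxE.
by apply: eq_bigr => j _; rewrite !mxE (pder_pd _ _ (dX i)).
Qed.

Section PoissonNijenhuis.
Variables (S : bivfield M) (N : endfield M).
Hypotheses (sS : smooth_bivfield S) (sN : smooth_endfield N).

Definition dend (j : 'I_n) : 'M[R]_n :=
  \matrix_(i, k) pd (chart_at p) j (fun q => endfield_in (chart_at p) N q i k) p.
Definition dbiv (j : 'I_n) : 'M[R]_n :=
  \matrix_(i, k) pd (chart_at p) j (fun q => bivfield_in (chart_at p) S q i k) p.

Lemma pder_end j : pder j (endfield_in c N) (dend j).
Proof. exact: pder_smooth (sN ac). Qed.

Lemma pder_biv j : pder j (bivfield_in c S) (dbiv j).
Proof. exact: pder_smooth (sS ac). Qed.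

Lemma near_dom : \forall q \near p, cdom c q.
Proof. exact: near_cdom. Qed.

(** For the coordinate fields e_x and e_y, [N e_x, e_y] = - (d_y N) e_x and
    [e_x, e_y] = 0. *)
Lemma torsion_coord (x y : 'I_n) :
  (forall X Y, smooth_vfield X -> smooth_vfield Y -> nijenhuis_torsion N X Y p = 0) ->
  N p *m col y (dend x) - N p *m col x (dend y) =
  \sum_j N p j x *: col y (dend j) - \sum_j N p j y *: col x (dend j).
Proof.
move=> T.
have [X [sX Xn]] := extend_vfield p (delta_mx x 0).
have [Y [sY Yn]] := extend_vfield p (delta_mx y 0).
have dcst Z (v : 'cV[R]_n) : (\forall q \near p, vfield_in c Z q = v) ->
    forall j, pder j (vfield_in c Z) 0.
  move=> Zn j; apply: (pder_near (F := fun=> v)); last exact: pder_cst.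
  by apply: filterS Zn => q ->.
have dN Z (k : 'I_n) : (\forall q \near p, vfield_in c Z q = delta_mx k 0) ->
    forall j, pder j (vfield_in c (end_vfield N Z)) (col k (dend j)).
  move=> Zn j; rewrite colE.
  apply: (pder_near (F := fun q => endfield_in c N q *m delta_mx k 0)).
    apply: filterS2 Zn near_dom => q Zq cq.
    by rewrite end_vfield_in// Zq.
  have := pder_mulmx (pder_end j) (pder_cst j (delta_mx k 0 : 'cV[R]_n)).
  by rewrite mulmx0 addr0.
have atp Z (v : 'cV[R]_n) : (\forall q \near p, vfield_in c Z q = v) -> Z p = v.
  by move=> /nbhs_singleton; rewrite vfield_at.
have Xp := atp _ _ Xn; have Yp := atp _ _ Yn.
have dX := dcst _ _ Xn; have dY := dcst _ _ Yn.
have dNX := dN _ _ Xn; have dNY := dN _ _ Yn.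
have sumd (k : 'I_n) (W : 'I_n -> 'cV[R]_n) :
    \sum_j (delta_mx k 0 : 'cV[R]_n) j 0 *: W j = W k.
  rewrite (bigD1 k)//= mxE !eqxx scale1r big1 ?addr0// => j jk.
  by rewrite mxE (negbTE jk) scale0r.
have sum0 (v : 'cV[R]_n) : \sum_j v j 0 *: (0 : 'cV[R]_n) = 0.
  by rewrite big1// => j _; rewrite scaler0.
have := T X Y sX sY; rewrite /nijenhuis_torsion /end_vfield.
rewrite -![fun q => N q *m X q]/(end_vfield N X) -![fun q => N q *m Y q]/(end_vfield N Y).
rewrite (lie_bracketE dNX dY) (lie_bracketE dX dNY) (lie_bracketE dX dY) (lie_bracketE dNX dNY).
rewrite Xp Yp !sumd !sum0 !sub0r ?oppr0 ?subr0 ?mulmx0 ?subr0 mulmxN addr0.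
rewrite [- (N p *m _) + _]addrC.
move/eqP; rewrite subr_eq0 => /eqP ->.
rewrite /end_vfield Xp Yp; congr (_ - _); apply: eq_bigr => j _; congr (_ *: _);
  by rewrite -colE mxE.
Qed.

End PoissonNijenhuis.

Lemma pder_skew j (F : M -> 'M[R]_n) D : (\forall q \near p, (F q)^T = - F q) ->
  pder j F D -> D^T = - D.
Proof.
move=> aF dF.
have h : pder j (fun q => (F q)^T) (- D).
  apply: (pder_near (F := fun q => (- 1%:M) *m F q)).
    by apply: filterS aF => q ->; rewrite mulNmx mul1mx.
  have := pder_mulmx (pder_cst j (- 1%:M)) dF.
  by rewrite mul0mx add0r mulNmx mul1mx.
by have [_ <-] := pder_trmx dF; have [_ <-] := h.
Qed.

(** In the defining formula, the terms that contain the derivatives of a and b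
    through d(pi(a, b)) and through the jacobians of the sharps cancel, because S
    is skew near p. *)
Lemma koszulE S a b DS Da Db :
  (\forall q \near p, (bivfield_in c S q)^T = - bivfield_in c S q) ->
  (forall j, pder j (bivfield_in c S) (DS j)) ->
  (forall j, pder j (oneform_in c a) (Da j)) ->
  (forall j, pder j (oneform_in c b) (Db j)) ->
  koszul_bracket S a b p =
    \sum_j (S p *m (a p)^T) j 0 *: Db j - \sum_j (S p *m (b p)^T) j 0 *: Da j
    + \row_i (b p *m DS i *m (a p)^T) 0 0.
Proof.
move=> aS dS da db.
have dsharp g Dg : (forall j, pder j (oneform_in c g) (Dg j)) ->
    forall j, pder j (vfield_in c (sharp S g)) (DS j *m (g p)^T + S p *m (Dg j)^T).
  move=> dg j.
  apply: (pder_near (F := fun q => bivfield_in c S q *m (oneform_in c g q)^T)).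
    by apply: filterS near_dom => q cq; rewrite sharp_in.
  have := pder_mulmx (dS j) (pder_trmx (dg j)).
  by rewrite oneform_at bivfield_at.
have aSp : (S p)^T = - S p by have := nbhs_singleton aS; rewrite bivfield_at.
have aDS j : (DS j)^T = - DS j by exact: pder_skew aS (dS j).
have skew (A : 'M[R]_n) (u v : 'rV[R]_n) : A^T = - A ->
    (u *m A *m v^T) 0 0 = - (v *m A *m u^T) 0 0.
  move=> aA; have -> : (u *m A *m v^T) 0 0 = ((u *m A *m v^T)^T) 0 0 by rewrite [RHS]mxE.
  by rewrite !trmx_mul trmxK aA mulNmx mulmxN mxE mulmxA.
rewrite /koszul_bracket.
rewrite (lie_oneformE (dsharp _ _ da) db) (lie_oneformE (dsharp _ _ db) da).
have dev : diffl (biv_eval S a b) p =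
    \row_i ((Db i *m S p + b p *m DS i) *m (a p)^T + b p *m S p *m (Da i)^T) 0 0.
  apply/rowP => i; rewrite [LHS]mxE [RHS]mxE.
  have h := pder_mulmx (pder_mulmx (db i) (dS i)) (pder_trmx (da i)).
  transitivity (pd c i (fun q =>
    (oneform_in c b q *m bivfield_in c S q *m (oneform_in c a q)^T) 0 0) p).
    apply: pd_near_eq => //; apply: filterS near_dom => q cq.
    by rewrite /biv_eval (pairing_in ac cq) sharp_in// mulmxA.
  by rewrite (pder_pd 0 0 h) !oneform_at bivfield_at.
have rowE3 (s1 s2 : 'rV[R]_n) (f g h : 'I_n -> R) (i : 'I_n) :
    (s1 + \row_k f k - (s2 + \row_k g k) - \row_k h k) 0 i =
    s1 0 i + f i - (s2 0 i + g i) - h i by rewrite !mxE.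
have rowE1 (s1 s2 : 'rV[R]_n) (f : 'I_n -> R) (i : 'I_n) :
    (s1 - s2 + \row_k f k) 0 i = s1 0 i - s2 0 i + f i by rewrite !mxE.
have addE (A B : 'M[R]_1) : (A + B) 0 0 = A 0 0 + B 0 0 by rewrite mxE.
rewrite dev /sharp; apply/rowP => i; rewrite rowE3 rowE1.
rewrite !mulmxDr mulmxDl !addE !mulmxA.
rewrite (skew _ (a p) (b p) (aDS i)) (skew _ (a p) (Db i) aSp).
by ring.
Qed.

Lemma delta_mx_entry (A : 'M[R]_n) (x y : 'I_n) :
  ((delta_mx 0 y : 'rV[R]_n) *m A *m (delta_mx 0 x : 'rV[R]_n)^T) 0 0 = A y x.
Proof. by rewrite -rowE trmx_delta -colE !mxE. Qed.

(** For f a k-th coordinate near p, whose differential is constant there, X(f) = X_k,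
    and the divergence of the hamiltonian vector field of f splits into the
    derivative of the density of mu and the trace of a jacobian. *)
Lemma modular_vfield_coord S (DS : 'I_n -> 'M[R]_n) mu X (v : 'I_n -> 'cV[R]_n) k :
  is_volume_form mu -> is_modular_vfield S mu X ->
  (forall j, pder j (bivfield_in c S) (DS j)) -> mu p v != 0 ->
  X p k 0 * mu p v =
    \sum_j S p j k * pd c j (fun q => topform_in c mu q v) p
    + (\sum_j DS j j k) * mu p v.
Proof.
move=> [_ mulin mualt _] [_ modX] dS v0.
have [f [sf fn]] := extend_coord p k.
have fnear : \forall q \near p, oneform_in c (diffl f) q = delta_mx 0 k.
  have fnn : \forall q \near p, \forall r \near q, f r = c r 0 k by exact: nbhs_interior fn.
  apply: filterS2 fnn near_dom => q fq cq.
  rewrite diffl_in//; apply/rowP => i; rewrite !mxE.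
  rewrite (pd_near_eq (g := fun r => c r 0 k) i cq fq).
  have := jac_id cq; move/matrixP/(_ k i); rewrite !mxE => ->.
  by rewrite eqxx eq_sym.
have dH j : pder j (vfield_in c (hamvf S f)) (col k (DS j)).
  rewrite colE -[delta_mx k 0]trmx_delta.
  apply: (pder_near (F := fun q => bivfield_in c S q *m (delta_mx 0 k)^T)).
    by apply: filterS2 fnear near_dom => q fq cq; rewrite sharp_in// fq.
  have := pder_mulmx (dS j) (pder_cst j (delta_mx 0 k : 'rV[R]_n)^T).
  by rewrite mulmx0 addr0.
have dfp : diffl f p = delta_mx 0 k by have := nbhs_singleton fnear; rewrite oneform_at.
have Hp : hamvf S f p = col k (S p) by rewrite /hamvf /sharp dfp trmx_delta -colE.
have := modX f sf p v.
have -> : act X f p = X p k 0 by rewrite /act /pairing dfp -rowE mxE.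
move=> <-; rewrite /lie_topform actE Hp (alternating_trace (mulin p) (mualt p) _ v0).
congr (_ + _ * _).
  by apply: eq_bigr => j _; rewrite mxE.
by apply: eq_bigr => j _; rewrite mxE (pder_pd _ _ (dH j)) mxE.
Qed.

Section Coordinates.
Variables (S : bivfield M) (N : endfield M).
Hypotheses (sS : smooth_bivfield S) (sN : smooth_endfield N).
Hypothesis NS : forall q, N q *m S q = S q *m (N q)^T.
Hypothesis aS : forall q, (S q)^T = - S q.

Lemma conj_compat (J J' A B : 'M[R]_n) : J' *m J = 1%:M -> A *m B = B *m A^T ->
  J *m A *m J' *m (J *m B *m J^T) = J *m B *m J^T *m (J *m A *m J')^T.
Proof.
move=> JJ AB; rewrite !trmx_mul !mulmxA -[_ *m J' *m J]mulmxA JJ mulmx1.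
by rewrite -[_ *m J^T *m J'^T]mulmxA -trmx_mul JJ trmx1 mulmx1 -[_ *m A *m B]mulmxA AB !mulmxA.
Qed.

Lemma compat_in q : cdom c q ->
  endfield_in c N q *m bivfield_in c S q = bivfield_in c S q *m (endfield_in c N q)^T.
Proof.
by move=> cq; apply: conj_compat (NS q); exact: chart_at_jac.
Qed.

Lemma skew_in q : (bivfield_in c S q)^T = - bivfield_in c S q.
Proof. by rewrite /bivfield_in !trmx_mul trmxK aS mulNmx mulmxN mulmxA. Qed.

Lemma dend_dbiv_compat j :
  dend N j *m S p + N p *m dbiv S j = dbiv S j *m (N p)^T + S p *m (dend N j)^T.
Proof.
have h1 := pder_mulmx (pder_end sN j) (pder_biv sS j).
have h2 := pder_mulmx (pder_biv sS j) (pder_trmx (pder_end sN j)).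
have h3 : pder j (fun q => endfield_in c N q *m bivfield_in c S q)
    (dbiv S j *m (endfield_in c N p)^T + bivfield_in c S p *m (dend N j)^T).
  apply: pder_near h2; apply: filterS near_dom => q cq.
  by rewrite compat_in.
rewrite endfield_at bivfield_at in h1 h3.
by have [_ <-] := h1; have [_ <-] := h3.
Qed.

Lemma dbiv_skew j : (dbiv S j)^T = - dbiv S j.
Proof.
apply: pder_skew (pder_biv sS j).
by apply: filterS near_dom => q _; exact: skew_in.
Qed.

Lemma pder_end_biv j : pder j (bivfield_in c (end_bivfield N S))
  (dend N j *m S p + N p *m dbiv S j).
Proof.
have := pder_mulmx (pder_end sN j) (pder_biv sS j).
rewrite endfield_at bivfield_at; apply: pder_near.
by apply: filterS near_dom => q cq; rewrite end_bivfield_in.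
Qed.

Lemma koszul_compat_coord :
  (forall a b, smooth_oneform a -> smooth_oneform b ->
        koszul_bracket (end_bivfield N S) a b p =
        koszul_bracket S (end_oneform N a) b p
        + koszul_bracket S a (end_oneform N b) p
        - end_oneform N (koszul_bracket S a b) p) ->
  forall x y i : 'I_n, (dend N i *m S p + N p *m dbiv S i) y x =
    - (\sum_j S p j y * dend N j x i) - \sum_j N p x j * dbiv S i j y
    + \sum_j S p j x * dend N j y i + \sum_j N p y j * dbiv S i j x
    - \sum_j dbiv S j y x * N p j i.
Proof.
move=> K x y i.
have [a [sa an]] := extend_oneform p (delta_mx 0 x).
have [b [sb bn]] := extend_oneform p (delta_mx 0 y).
have dcst g (w : 'rV[R]_n) : (\forall q \near p, oneform_in c g q = w) ->
    forall j, pder j (oneform_in c g) 0.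
  move=> gn j; apply: (pder_near (F := fun=> w)); last exact: pder_cst.
  by apply: filterS gn => q ->.
have dN g (k : 'I_n) : (\forall q \near p, oneform_in c g q = delta_mx 0 k) ->
    forall j, pder j (oneform_in c (end_oneform N g)) (row k (dend N j)).
  move=> gn j; rewrite rowE.
  apply: (pder_near (F := fun q => delta_mx 0 k *m endfield_in c N q)).
    by apply: filterS2 gn near_dom => q gq cq; rewrite end_oneform_in// gq.
  have := pder_mulmx (pder_cst j (delta_mx 0 k : 'rV[R]_n)) (pder_end sN j).
  by rewrite mul0mx add0r.
have atp g (w : 'rV[R]_n) : (\forall q \near p, oneform_in c g q = w) -> g p = w.
  by move=> /nbhs_singleton; rewrite oneform_at.
have ap := atp _ _ an; have bp := atp _ _ bn.
have da := dcst _ _ an; have db := dcst _ _ bn.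
have dNa := dN _ _ an; have dNb := dN _ _ bn.
have aSn : \forall q \near p, (bivfield_in c S q)^T = - bivfield_in c S q.
  by apply: filterS near_dom => q _; exact: skew_in.
have aNSn : \forall q \near p, (bivfield_in c (end_bivfield N S) q)^T =
    - bivfield_in c (end_bivfield N S) q.
  apply: filterS near_dom => q cq.
  by rewrite end_bivfield_in// trmx_mul skew_in mulNmx compat_in.
have := K a b sa sb.
rewrite (koszulE aNSn pder_end_biv da db).
rewrite (koszulE aSn (pder_biv sS) dNa db) (koszulE aSn (pder_biv sS) da dNb).
rewrite /end_oneform (koszulE aSn (pder_biv sS) da db) ap bp.
have sum0 (v : 'cV[R]_n) : \sum_j v j 0 *: (0 : 'rV[R]_n) = 0.
  by rewrite big1// => j _; rewrite scaler0.
rewrite !sum0 !subr0 !sub0r ?oppr0 ?add0r => /rowP/(_ i).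
have E3 (s1 s2 : 'rV[R]_n) (s3 : 'rV[R]_n) (f g : 'I_n -> R) :
    (- s1 + \row_k f k + (s2 + \row_k g k) - s3) 0 i =
    - s1 0 i + f i + (s2 0 i + g i) - s3 0 i by rewrite !mxE.
rewrite E3 [LHS]mxE delta_mx_entry => ->.
rewrite addrA; congr (- _ + _ + _ + _ - _).
- rewrite summxE; apply: eq_bigr => j _.
  by rewrite trmx_delta -colE mxE [col _ _ _ _]mxE [row _ _ _ _]mxE.
- rewrite -!rowE mxE -sumrN; apply: eq_bigr => j _.
  have /matrixP/(_ j y) := dbiv_skew i; rewrite [LHS]mxE [RHS]mxE => E.
  by rewrite [row _ _ _ _]mxE E [_^T _ _]mxE [row _ _ _ _]mxE mulNr mulrC.
- rewrite summxE; apply: eq_bigr => j _.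
  by rewrite trmx_delta -colE mxE [col _ _ _ _]mxE [row _ _ _ _]mxE.
- by rewrite -mulmxA -mulmxA mulmxA mulmxA -[X in X *m _]mulmxA delta_mx_entry mxE.
- by rewrite mxE; apply: eq_bigr => j _; rewrite mxE delta_mx_entry.
Qed.

(** The densities of mu contribute the same term to X^1 and N X^0, as
    N S e_k = sum_i N_ki S e_i, and so do the derivatives of S. *)
Lemma pn_modular_coord mu X0 X1 k : is_volume_form mu ->
  is_modular_vfield S mu X0 -> is_modular_vfield (end_bivfield N S) mu X1 ->
  X1 p k 0 - (N p *m X0 p) k 0 = \sum_i \sum_j S p j i * dend N j k i.
Proof.
move=> vmu mX0 mX1; have [_ _ _ nz] := vmu; have [v v0] := nz p.
apply: (mulIf v0).
rewrite mulrBl (modular_vfield_coord k vmu mX1 pder_end_biv v0).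
set gam := fun j => pd c j (fun q => topform_in c mu q v) p.
have -> : (N p *m X0 p) k 0 * mu p v = \sum_i N p k i *
    (\sum_j S p j i * gam j + (\sum_j dbiv S j j i) * mu p v).
  rewrite mxE mulr_suml; apply: eq_bigr => i _.
  by rewrite -(modular_vfield_coord i vmu mX0 (pder_biv sS) v0) mulrA.
have -> : \sum_i N p k i * (\sum_j S p j i * gam j + (\sum_j dbiv S j j i) * mu p v) =
  \sum_j (\sum_i S p j i * N p k i) * gam j +
  (\sum_j \sum_i dbiv S j j i * N p k i) * mu p v.
  under eq_bigr do rewrite mulrDr.
  rewrite big_split /=; congr (_ + _).
    under eq_bigr do rewrite mulr_sumr.
    rewrite exchange_big /=; apply: eq_bigr => j _; rewrite mulr_suml.
    by apply: eq_bigr => i _; ring.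
  rewrite exchange_big mulr_suml; apply: eq_bigr => i _.
  rewrite mulrA mulr_sumr; congr (_ * _); apply: eq_bigr => j _.
  exact: mulrC.
have -> : \sum_j end_bivfield N S p j k * gam j =
    \sum_j (\sum_i S p j i * N p k i) * gam j.
  apply: eq_bigr => j _; rewrite /end_bivfield NS mxE; congr (_ * _).
  by apply: eq_bigr => i _; rewrite mxE.
have -> : \sum_j (dend N j *m S p + N p *m dbiv S j) j k =
    \sum_j \sum_i dbiv S j j i * N p k i + \sum_j \sum_i S p j i * dend N j k i.
  rewrite -big_split /=; apply: eq_bigr => j _; rewrite dend_dbiv_compat [LHS]mxE.
  rewrite [X in X + _]mxE [X in _ + X]mxE.
  by congr (_ + _); apply: eq_bigr => i _; rewrite [_^T _ _]mxE.
rewrite mulrDl [X in _ = X * _]exchange_big /=.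
by ring.
Qed.

Hypothesis uN : forall q, N q \in unitmx.

Lemma diffl_h i : diffl (h_ N i) p =
  \row_j - (2^-1 * \tr (mxpowz (N p) (i - 1) *m dend N j)).
Proof.
apply/rowP => j; rewrite !mxE.
have oU := @open_cimage _ _ _ c.
have Up : (c @` cdom c) (c p) by exists p.
have uNx x : (c @` cdom c) x -> endfield_in c N (cinv c x) \in unitmx.
  by move=> Ux; have [cx _] := cinv_dom Ux; exact: endfield_in_unit.
have dI : derivable (fun x => invmx (endfield_in c N (cinv c x))) (c p) (delta_mx 0 j).
  apply: (derivable_mxP _ _ _).2 => k l.
  exact: smooth_derivable (smooth_invmx oU (sN ac) uNx k l) Up.
have un : \forall x \near c p, endfield_in c N (cinv c x) \in unitmx.
  by apply: filterS uNx _; exact: open_nbhs_nbhs.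
have [_] := is_derive_power_trace i (pder_end sN j) un dI.
rewrite cmap_inv// endfield_at => <-.
apply: near_eq_derive; have := near_cinv cp near_dom; apply: filterS => x [_ cx] /=.
by rewrite (h_in ac cx).
Qed.

End Coordinates.

End LocalDerivatives.

Opaque dend dbiv.

(** * The Lenard recursion and the modular vector field *)

Section Hierarchy.
Context {R : realType} {n : nat} {M : smoothManifold R n}.
Variables (S : bivfield M) (N : endfield M).
Hypotheses (sN : smooth_endfield N) (uN : forall p, N p \in unitmx).
Hypothesis NS : forall p, N p *m S p = S p *m (N p)^T.
Hypothesis torsion0 : forall X Y, smooth_vfield X -> smooth_vfield Y ->
  forall p, nijenhuis_torsion N X Y p = 0.

Lemma diffl_h_succ p i : diffl (h_ N (i + 1)) p = diffl (h_ N i) p *m N p.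
Proof.
rewrite !diffl_h//; apply/rowP => a; rewrite [LHS]mxE [RHS]mxE addrK.
have T x y := torsion_coord sN x y (fun X Y sX sY => torsion0 sX sY p).
have NE : mxpowz (N p) (i - 1) *m N p = mxpowz (N p) i.
  by rewrite (mxpowz_comm _ (uN p)) -(mxpowzS _ (uN p)) subrK.
transitivity (- (2^-1 * \sum_j N p j a * \tr (mxpowz (N p) (i - 1) *m dend p N j))).
  by rewrite (lenard_trace T a (mxpowz_comm _ (uN p))) NE.
rewrite mulr_sumr -sumrN; apply: eq_bigr => j _.
by rewrite [in RHS]mxE; ring.
Qed.

(** For negative i the recursion is run backwards, N being invertible. *)
Lemma diffl_h_powz p i : diffl (h_ N i) p = diffl (h_ N 0) p *m mxpowz (N p) i.
Proof.
elim/int_rect: i => [|k IH|k IH].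
- by rewrite /= mulmx1.
- by rewrite -(addn1 k) PoszD diffl_h_succ mxpowzS// -mxpowz_comm// mulmxA IH.
- rewrite -(addn1 k) PoszD opprD.
  have H := diffl_h_succ p (- k%:Z - 1); rewrite subrK IH in H.
  apply: (can_inj (mulmxK (uN p))); rewrite -H -mulmxA mxpowz_comm//.
  by rewrite -mxpowzS// subrK.
Qed.

Lemma hamvf_pi i j : hamvf (pi_ S N i) (h_ N j) = hamvf S (h_ N (i + j)).
Proof.
apply/funext => p; rewrite /hamvf /sharp /pi_ /end_bivfield.
rewrite -[end_powz N i p]/(mxpowz (N p) i) (diffl_h_powz p j) (diffl_h_powz p (i + j)).
rewrite !trmx_mul !mulmxA -[mxpowz _ i *m _ *m _]mulmxA.
rewrite !(mxpowz_tr _ (uN p) (NS p)) mulmxA.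
by rewrite -mxpowzD.
Qed.

Lemma pn_modular_vfieldE mu X0 X1 : smooth_bivfield S ->
  (forall p, (S p)^T = - S p) ->
  (forall a b, smooth_oneform a -> smooth_oneform b -> forall p,
     koszul_bracket (end_bivfield N S) a b p =
     koszul_bracket S (end_oneform N a) b p
     + koszul_bracket S a (end_oneform N b) p
     - end_oneform N (koszul_bracket S a b) p) ->
  is_volume_form mu -> is_modular_vfield S mu X0 ->
  is_modular_vfield (end_bivfield N S) mu X1 ->
  pn_modular_vfield N X0 X1 = hamvf S (h_ N 1).
Proof.
move=> sS aS kos vmu hX0 hX1.
apply/funext => p; apply/colP => k; rewrite [LHS]mxE [(- _ : 'cV_n) _ _]mxE.
rewrite (pn_modular_coord p sS sN NS k vmu hX0 hX1).
have K := koszul_compat_coord sS sN NS aS (fun a b sa sb => kos a b sa sb p).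
rewrite (koszul_trace (aS p) (dbiv_skew p sS aS) (dend_dbiv_compat p sS sN NS) K).
rewrite /hamvf /sharp diffl_h// mxE mulr_sumr -sumrN; apply: eq_bigr => j _.
by rewrite !mxE subrr mul1mx; ring.
Qed.

End Hierarchy.

Theorem theorem2 (R : realType) (n : nat) (M : smoothManifold R n)
    (pi0 : bivfield M) (N : endfield M) (mu : topform M) (X0 X1 : vfield M)
    (hPN : is_poisson_nijenhuis pi0 N)
    (hN : forall p : M, N p \in unitmx)
    (hmu : is_volume_form mu)
    (hX0 : is_modular_vfield pi0 mu X0)
    (hX1 : is_modular_vfield (end_bivfield N pi0) mu X1) :
  (is_hamiltonian pi0 (pn_modular_vfield N X0 X1) /\
   is_hamiltonian (end_bivfield N pi0) (pn_modular_vfield N X0 X1)) /\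
  (forall i : int, smooth (h_ N i)) /\
  exists X : int -> vfield M,
    [/\ forall k : int, smooth_vfield (X k),
        X 1%R = pn_modular_vfield N X0 X1 &
        forall i j : int,
          X (i + j)%R = hamvf (pi_ pi0 N i) (h_ N j) /\
          X (i + j)%R = hamvf (pi_ pi0 N j) (h_ N i)].
Proof.
have [[[sS skS] _] sN tors NSh kos] := hPN.
have NS q : N q *m pi0 q = pi0 q *m (N q)^T.
  apply/matrixP => i k.
  have := NSh (fun=> delta_mx 0 k) q; rewrite /end_vfield /sharp /end_oneform.
  rewrite trmx_mul trmx_delta !mulmxA -!colE => /colP/(_ i).
  by rewrite [LHS]mxE [RHS]mxE.
have aS q : (pi0 q)^T = - pi0 q.
  apply/matrixP => i k; rewrite [LHS]mxE [RHS]mxE.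
  have := skS (fun=> delta_mx 0 i) (fun=> delta_mx 0 k) q.
  by rewrite /biv_eval /pairing /sharp !mulmxA !delta_mx_entry.
have sh i : smooth (h_ N i) by exact: smooth_h.
have ham i j := hamvf_pi sN hN NS tors i j.
have X1E := pn_modular_vfieldE sN hN NS sS aS kos hmu hX0 hX1.
split; [split|split=> //].
- by exists (h_ N 1).
- exists (h_ N 0); split => //; rewrite X1E -[1]addr0 -ham.
  by congr hamvf; apply/funext => p; rewrite /pi_ /end_bivfield /= expr1.
- exists (fun k => hamvf pi0 (h_ N k)); split=> [k||i j].
  + exact: smooth_hamvf.
  + by rewrite X1E.
  + by rewrite !ham [j + i]addrC.
Qed.
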